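(* Let $G=\operatorname{SL}(V)$ with $\dim V=n\ge 2$. Let $u\in G$ be unipotent and $V\cong V_{d_1}\oplus\cdots\oplus V_{d_t}$ as $K[u]$-modules ($t\ge1$, $d_r\ge1$, repetitions allowed). Set $\alpha=\nu_2(\gcd(d_1,\dots,d_t))$. Write $V\otimes V^*\cong\bigoplus_{d\ge1}V_d^{\lambda(d)}$ and $L_G(\varpi_1+\varpi_{n-1})\cong\bigoplus_{d\ge1}V_d^{\lambda'(d)}$ as $K[u]$-modules. Set $\varepsilon:=\varepsilon_{V\otimes V^*,b_V}$ and $\varepsilon':=\varepsilon_{L_G(\varpi_1+\varpi_{n-1}),b_V}$ (with $L_G(\varpi_1+\varpi_{n-1})$ identified with $\langle\gamma_V\rangle^\perp/\langle\gamma_V\rangle$ and its induced form). Then: (i) If $2\nmid n$: $\lambda'(1)=\lambda(1)-1$ and $\lambda'(d)=\lambda(d)$ for $d>1$. (ii) If $2\mid n$ and $\alpha=0$: $\lambda'(1)=\lambda(1)-2$ and $\lambda'(d)=\lambda(d)$ for $d>1$. (iii) If $2\mid n$ and $\alpha>0$: (a) if $2\mid n/2^\alpha$, then $\lambda'(2^\alpha)=\lambda(2^\alpha)-2$, $\lambda'(2^\alpha-1)=2$, and $\lambda'(d)=\lambda(d)$ for $d\ne 2^\alpha,2^\alpha-1$; (b) if $\alpha>1$ and $2\nmid n/2^\alpha$, then $\lambda'(2^\alpha)=\lambda(2^\alpha)-1$, $\lambda'(2^\alpha-2)=1$, and $\lambda'(d)=\lambda(d)$ for $d\ne2^\alpha,2^\alpha-2$;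 (c) if $\alpha=1$ and $2\nmid n/2$, then $\lambda'(2)=\lambda(2)-1$ and $\lambda'(d)=\lambda(d)$ for $d\neq 2$. (iv) $\varepsilon(d)=1$ if and only if $d=2^\beta>1$ for some power $2^\beta$ occurring in the consecutive-ones binary expansion of $d_r$ for some $1\le r\le t$. (v) If case (iii)(b) holds, then $\varepsilon(2^\alpha-2)=0$, $\varepsilon'(2^\alpha-2)=1$, and $\varepsilon'(d)=\varepsilon(d)$ for all $d\ne2^\alpha-2$. (vi) If case (iii)(b) does not hold, then $\varepsilon'(d)=\varepsilon(d)$ for all $d\ge1$.
   Context: $K$ is an algebraically closed field of characteristic $2$. For a unipotent element $u$ (of order a power of $2$, say $q$), $K[u]$ is the group algebra of $\langle u\rangle$, $X=u-1$, and $V_d$ ($1\le d\le q$) is the $d$-dimensional indecomposable $K[u]$-module on which $u$ acts as a single unipotent Jordan block; $V_0=0$, $V^m$ denotes the direct sum of $m$ copies. $\nu_2$ is the $2$-adic valuation. For a $K$-vector space $W$ with a $u$-invariant alternating bilinear form $b$ (not necessarily non-degenerate), define $\varepsilon_{W,b}:\mathbb{Z}_{\ge1}\to\{0,1\}$ by $\varepsilon_{W,b}(d)=0$ if $b(X^{d-1}v,v)=0$ for all $v\in W$ with $X^dv=0$, and $\varepsilon_{W,b}(d)=1$ otherwise. The bilinear form $b_V$ on $V\otimes V^*$ is defined by $b_V(v\otimes f,v'\otimes f')=f(v')f'(v)+f(v)f'(v')$; it is $\operatorname{SL}(V)$-invariant and alternating. With a basis $e_1,\dots,e_n$ of $V$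 and dual basis $e_i^*$, $\gamma_V=\sum_i e_i\otimes e_i^*$ (independent of the basis; spans the $G$-fixed points). $L_G(\lambda)$ denotes the irreducible rational $K[G]$-module of highest weight $\lambda$, with fundamental weights $\varpi_i$ labelled as in Bourbaki; $L_G(\varpi_1+\varpi_{n-1})\cong\langle\gamma_V\rangle^\perp/\langle\gamma_V\rangle$ (perp with respect to $b_V$), and $b_V$ induces a non-degenerate alternating form on this quotient. The consecutive-ones binary expansion of an integer $m>0$ is the expression $m=\sum_{i=1}^k(-1)^{i+1}2^{e_i}$ with $e_1>\cdots>e_k\ge0$ and $k$ minimal; a power $2^\beta$ ''occurs'' in it if $\beta=e_i$ for some $i$. *)

(* Defs.v *)
From HB Require Import structures.
From mathcomp Require Import all_boot all_order all_algebra.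
Set Implicit Arguments. Unset Strict Implicit. Unset Printing Implicit Defensive.
Import Order.TTheory GRing.Theory Num.Theory.
Local Open Scope ring_scope.

Section Defs.
Variable K : fieldType.

(* Nilpotent part X = u - 1 of the module V_{s_1} (+) ... (+) V_{s_k}:
   acting on row vectors (v |-> v *m J), the standard basis vectors form
   chains e_a -> e_{a+1} -> ... -> e_{a+d-1} -> 0, one per block. *)
Definition jordan_nil (s : seq nat) : 'M[K]_(sumn s) :=
  \matrix_(i < sumn s, j < sumn s)
    ((((j : nat) == (i : nat).+1) && ((j : nat) \notin scanl addn 0%N s)) %:R).

(* The subquotient U/U' of the K[u]-module 'rV_m (u acting by v |-> v *m (1 + X))
   is isomorphic to V_{s_1} (+) ... (+) V_{s_k}: phi sends the standard basis of
   the Jordan module into U, induces a bijection onto U/U', and intertwines X. *)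
Definition jordan_iso (m p q : nat) (X : 'M[K]_m) (U : 'M[K]_(p, m))
    (U' : 'M[K]_(q, m)) (s : seq nat) : Prop :=
  exists phi : 'M[K]_(sumn s, m),
    [/\ (phi <= U)%MS, (U <= phi + U')%MS,
        (forall w : 'rV[K]_(sumn s), (w *m phi <= U')%MS -> w = 0) &
        (jordan_nil s *m phi - phi *m X <= U')%MS].

Definition mult_decomp (m p q : nat) (X : 'M[K]_m) (U : 'M[K]_(p, m))
    (U' : 'M[K]_(q, m)) (lam : nat -> nat) : Prop :=
  exists s : seq nat,
    [/\ all (fun d => 0 < d)%N s,
        (forall d, 0 < d -> count_mem d s = lam d)%N &
        jordan_iso X U U' s].

Definition eps_one (m p q : nat) (X : 'M[K]_m) (b : 'rV[K]_m -> 'rV[K]_m -> K)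
    (U : 'M[K]_(p, m)) (U' : 'M[K]_(q, m)) (d : nat) : Prop :=
  exists v : 'rV[K]_m,
    [/\ (v <= U)%MS, (v *m X ^+ d <= U')%MS & b (v *m X ^+ d.-1) v != 0].

(* V = 'rV_n with u acting by v |-> v *m u; V^* = column vectors, u acting by
   f |-> invmx u *m f;  V (x) V^* = 'M_n via v (x) f |-> f *m v, so u acts by
   A |-> invmx u *m A *m u.  We vectorize 'M_n as 'rV_(n*n) via mxvec. *)
Definition tens_op (n : nat) (u : 'M[K]_n) : 'M[K]_(n * n) :=
  lin_mx (fun A : 'M[K]_n => invmx u *m A *m u) - 1%:M.

(* b_V(v (x) f, v' (x) f') = f(v') f'(v) + f(v) f'(v') = tr(AB) + tr A tr B. *)
Definition bV (n : nat) (x y : 'rV[K]_(n * n)) : K :=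
  \tr (vec_mx x *m vec_mx y) + \tr (vec_mx x) * \tr (vec_mx y).

(* gamma_V = sum_i e_i (x) e_i^* = identity matrix. *)
Definition gamma (n : nat) : 'rV[K]_(n * n) := mxvec (1%:M : 'M[K]_n).

Definition gamma_perp (n : nat) : 'M[K]_(n * n) :=
  kermx (\col_(i < n * n) bV (delta_mx 0 i) (gamma n)).

End Defs.

Fixpoint alt_val (es : seq nat) : int :=
  match es with
  | [::] => 0
  | e :: es' => (2 ^ e)%N%:Z - alt_val es'
  end.

Definition cob_expansion (es : seq nat) (m : nat) : Prop :=
  sorted (fun a b => b < a)%N es /\ alt_val es = m%:Z.

Definition occurs_cob (beta m : nat) : Prop :=
  exists es, [/\ cob_expansion es m,
                 (forall es', cob_expansion es' m -> size es <= size es')%N &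
                 beta \in es].

(* Main.v *)
Require Import Defs.
From HB Require Import structures.
From mathcomp Require Import all_boot all_order all_algebra.
From mathcomp Require Import zify.
Set Implicit Arguments. Unset Strict Implicit. Unset Printing Implicit Defensive.
Import GRing.Theory.
Local Open Scope ring_scope.

(* Put z = u - 1 and ad A = z A + A z on End(V), the commutator with z since
   char K = 2.  Conjugation satisfies X^m A = u^-m ad^m A, and ad is self-adjoint
   for the trace form, so everything is expressed through ad and traces.

   For q = 2h a power of 2 one has ad^q A = z^q A + A z^q and
   ad^(q-1) A = sum_l z^l A z^(q-1-l); pairing off equal terms in the trace gives
   b(X^(q-1) A, A) = tr(z^h A)^2 whenever ad^q A = 0.  Hence eps(q) = 1 iff some A
   commuting with z^q has tr(z^h A) <> 0, which is decided on each Jordan block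
   V_d: it happens iff h < d mod 2q < 3h, that is, iff q occurs in the
   consecutive-ones expansion of d.  For h < m < q the form A |-> b(X^(m-1) A, A)
   vanishes on ker X^m: it is additive, so only the blocks End(V_d) matter, and
   there ker X and im X^(m-1) intersect inside im X^(q-1).

   For q = 2^alpha there is T with X^(q-1) T = 1 and tr T = n / q, and there is
   A in ker X^q with tr A = 1.  So ker X^k is traceless iff k < q, and 1 lies in
   X^k(sl(V)) iff k < q - 1, or k = q - 1 and n / q is even.  This gives the ranks of
   X^k on the subquotient, whose second differences are the multiplicities, and
   T also computes the induced form on the vectors with X^d A = 1. *)

(** * The commutator with z in characteristic 2 *)

Section Anticommutator.
Variables (K : fieldType) (n : nat) (z : 'M[K]_n).
Implicit Types A B C : 'M[K]_n.

Definition adn (m : nat) A := iter m (fun A => z * A + A * z) A.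

Lemma adn_is_linear m : linear (adn m).
Proof.
rewrite /adn; elim: m => //= m IH a A B; rewrite IH !mulrDr !mulrDl scalerDr.
by rewrite -!mulmxE -!scalemxAl -!scalemxAr addrACA.
Qed.
HB.instance Definition _ m :=
  GRing.isLinear.Build K 'M[K]_n 'M[K]_n _ (adn m) (adn_is_linear m).

Lemma adn0 A : adn 0 A = A. Proof. by []. Qed.
Lemma adnS m A : adn m.+1 A = z * adn m A + adn m A * z. Proof. by []. Qed.
Lemma adnD l m A : adn (l + m) A = adn l (adn m A).
Proof. exact: iterD. Qed.
Lemma adnSr m A : adn m.+1 A = adn m (z * A + A * z).
Proof. by rewrite -addn1 adnD. Qed.

Lemma adn_mull m C A : GRing.comm C z -> adn m (C * A) = C * adn m A.
Proof.
by move=> cCz; elim: m => //= m ->; rewrite mulrDr !mulrA cCz.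
Qed.

Lemma adn_mulr m C A : GRing.comm C z -> adn m (A * C) = adn m A * C.
Proof.
by move=> cCz; elim: m => //= m ->; rewrite mulrDl -!mulrA cCz.
Qed.

Lemma mxtrace_mulrC A B : \tr (A * B) = \tr (B * A).
Proof. exact: mxtrace_mulC. Qed.

Lemma mxtrace_adn m A B : \tr (adn m A * B) = \tr (A * adn m B).
Proof.
elim: m A B => // m IH A B; rewrite adnSr IH adnS.
rewrite mulrDl mulrDr !raddfD /= addrC mulrA; congr (_ + _).
by rewrite -mulrA [LHS]mxtrace_mulC mulrA.
Qed.

Lemma adn_ker_le l m A : (l <= m)%N -> adn l A = 0 -> adn m A = 0.
Proof. by move=> /subnK <- H; rewrite adnD H linear0. Qed.

Hypothesis hK : 2%N \in [pchar K].

Lemma mxD_pchar2 m1 m2 (A : 'M[K]_(m1, m2)) : A + A = 0.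
Proof. by apply/matrixP=> i j; rewrite !mxE addrr_pchar2. Qed.

Lemma mxN_pchar2 m1 m2 (A : 'M[K]_(m1, m2)) : - A = A.
Proof. by apply/eqP; rewrite -subr_eq0 -opprD mxD_pchar2 oppr0. Qed.

Lemma mxB_eq0_pchar2 m1 m2 (A B : 'M[K]_(m1, m2)) : A + B = 0 -> A = B.
Proof. by move/eqP; rewrite addr_eq0 mxN_pchar2 => /eqP. Qed.

Lemma adn1_eq0 A : adn 1 A = 0 -> GRing.comm A z.
Proof. by move=> H; apply/esym/mxB_eq0_pchar2. Qed.

Lemma adn_last_comm m A : adn m.+1 A = 0 -> GRing.comm (adn m A) z.
Proof. by move=> H; apply/adn1_eq0; rewrite -adnD. Qed.

(** Left and right multiplication by z commute, so Frobenius applies to their sum. *)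
Lemma adn_exp2 k A : adn (2 ^ k) A = z ^+ (2 ^ k) * A + A * z ^+ (2 ^ k).
Proof.
elim: k A => [|k IH] A; first by rewrite !expr1 /=.
rewrite expnS mul2n -addnn adnD !IH !exprD mulrDr mulrDl !mulrA.
by rewrite addrACA !addrA -[X in X + _]addrA mxD_pchar2 addr0.
Qed.

Lemma adn_exp2_eq0 k A : adn (2 ^ k) A = 0 <-> GRing.comm A (z ^+ (2 ^ k)).
Proof.
rewrite adn_exp2; split=> [/mxB_eq0_pchar2 //|->].
by rewrite mxD_pchar2.
Qed.

(** All binomial coefficients of 2^k - 1 are odd; the induction splits 2q - 1 as q + (q - 1). *)
Lemma adn_exp2_pred k A :
  adn (2 ^ k).-1 A = \sum_(l < 2 ^ k) z ^+ l * A * z ^+ ((2 ^ k).-1 - l).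
Proof.
elim: k A => [|k IH] A; first by rewrite big_ord1 expr0 mul1r mulr1.
rewrite expnS mul2n -addnn.
have q_gt0 : (0 < 2 ^ k)%N by rewrite expn_gt0.
have -> : (2 ^ k + 2 ^ k).-1 = (2 ^ k + (2 ^ k).-1)%N by lia.
rewrite adnD IH adn_exp2 big_split_ord /= addrC; congr (_ + _); last first.
  rewrite mulr_suml; apply: eq_bigr => l _.
  by rewrite -mulrA -exprD; congr (_ * _ ^+ _); have := ltn_ord l; lia.
rewrite mulr_sumr; apply: eq_bigr => l _.
by rewrite !mulrA -exprD; congr (_ * _ ^+ _); have := ltn_ord l; lia.
Qed.

(** Each off-diagonal product of A i j and A j i occurs twice and cancels; the squares on the
    diagonal add up to the square of the trace. *)
Lemma mxtrace_sqr A : \tr (A * A) = \tr A ^+ 2.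
Proof.
have sqrD (I : finType) (f : I -> K) (P : pred I) :
    (\sum_(i | P i) f i) ^+ 2 = \sum_(i | P i) f i ^+ 2.
  by apply: (big_morph (fun x => x ^+ 2)) => [x y|]; rewrite ?expr0n //
    -!(pFrobenius_autE hK) rmorphD.
rewrite /mxtrace sqrD.
under eq_bigr => i _ do rewrite -mulmxE mxE (bigD1 i) //= -expr2.
rewrite big_split /= -[RHS]addr0; congr (_ + _).
rewrite (exchange_big_dep xpredT) //=.
have -> : \sum_(j < n) \sum_(i < n | j != i) A i j * A j i =
   \sum_(j < n) \sum_(i < n) (if (i < j)%N then A i j * A j i else 0) +
   \sum_(j < n) \sum_(i < n) (if (j < i)%N then A i j * A j i else 0).
  rewrite -big_split; apply: eq_bigr => j _; rewrite -big_split big_mkcond /=.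
  apply: eq_bigr => i _; rewrite -val_eqE /=.
  by case: ltngtP; rewrite ?addr0 ?add0r.
rewrite [X in _ + X]exchange_big /= -big_split big1 // => j _.
rewrite -big_split big1 // => i _ /=.
by case: ifP; rewrite ?addr0 // [A j i * _]mulrC addrr_pchar2.
Qed.

End Anticommutator.
Arguments adn : simpl never.

(** * A single Jordan block *)

Section JordanBlock.
Variable K : fieldType.

Definition jblock d : 'M[K]_d := \matrix_(i, j) ((j : nat) == i.+1)%:R.

Section Entries.
Variable d : nat.
Implicit Types F : nat -> nat -> K.
Local Notation J := (jblock d).

(** Entries are functions on [nat], so that shifted indices carry no bound; rows taken from beyond
    the end are zero. *)
Lemma mul_jblockX k F :
  J ^+ k * (\matrix_(i, j) F i j) =
  \matrix_(i, j) (if (i + k < d)%N then F (i + k)%N j else 0).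
Proof.
elim: k F => [|k IH] F.
  by apply/matrixP=> i j; rewrite expr0 mul1r !mxE addn0 ltn_ord.
rewrite exprSr -mulrA.
pose F' i j := if (i.+1 < d)%N then F i.+1 j else 0.
have -> : J * (\matrix_(i, j) F i j) = \matrix_(i, j) F' i j.
  apply/matrixP=> i j; rewrite -mulmxE !mxE /F'.
  case: ltnP => hi.
    rewrite (bigD1 (Ordinal hi)) //= !mxE eqxx mul1r big1 ?addr0 // => l.
    by rewrite -val_eqE !mxE /= => /negPf ->; rewrite mul0r.
  rewrite big1 // => l _; rewrite !mxE.
  by case: eqP => [e|]; rewrite ?mul0r //; have := ltn_ord l; lia.
rewrite IH /F'; apply/matrixP=> i j; rewrite !mxE addnS.
by case: (ltnP (i + k) d) => // h; rewrite ltnNge leqW.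
Qed.

Lemma jblockXE k : J ^+ k = \matrix_(i, j) ((j : nat) == i + k)%N%:R.
Proof.
have := mul_jblockX k (fun i j => (j == i)%N%:R).
have -> : \matrix_(i < d, j < d) ((j : nat) == i)%N%:R = 1 :> 'M[K]_d.
  by apply/matrixP=> i j; rewrite !mxE -val_eqE eq_sym.
rewrite mulr1 => ->; apply/matrixP=> i j; rewrite !mxE.
by case: ltnP => // h; case: eqP => // e; have := ltn_ord j; lia.
Qed.

Lemma mul_Xjblock k F :
  (\matrix_(i, j) F i j) * J ^+ k =
  \matrix_(i, j) (if (k <= j)%N then F i (j - k)%N else 0).
Proof.
rewrite jblockXE; apply/matrixP=> i j; rewrite -mulmxE !mxE.
case: leqP => hj.
  have hj' : (j - k < d)%N by have := ltn_ord j; lia.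
  rewrite (bigD1 (Ordinal hj')) //= !mxE /= subnK // eqxx mulr1 big1 ?addr0 //.
  move=> l; rewrite -val_eqE !mxE /=; case: eqP => //.
  by case: eqP; rewrite ?mulr0 //; lia.
by rewrite big1 // => l _; rewrite !mxE; case: eqP; rewrite ?mulr0 //; lia.
Qed.

End Entries.

(** Commuting with J makes D constant along diagonals and zero below the main one, so its first row
    lists the coefficients. *)
Lemma comm_jblock_sum d (D : 'M[K]_d) : GRing.comm D (jblock d) ->
  exists p : nat -> K, D = \sum_(k < d) p k *: jblock d ^+ k.
Proof.
case: d D => [|d'] D cDJ; first by exists (fun=> 0); apply/matrixP=> -[].
pose p k := D 0 (inord k); exists p.
pose G i j := D (inord i) (inord j).
have eD : D = \matrix_(i, j) G i j.
  by apply/matrixP=> i j; rewrite mxE /G !inord_val.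
have step i j : (i.+1 < d'.+1)%N -> (j < d'.+1)%N ->
    D (inord i.+1) (inord j) =
    if (0 < j)%N then D (inord i) (inord j.-1) else 0.
  move=> hi hj; move: cDJ; rewrite /GRing.comm -(expr1 (jblock _)).
  rewrite {1 2}eD mul_Xjblock mul_jblockX => /matrixP/(_ (inord i) (inord j)).
  by rewrite !mxE /G !inordK ?addn1 ?subn1 ?hi //; lia.
have pE i j : (i < d'.+1)%N -> (j < d'.+1)%N ->
    D (inord i) (inord j) = if (i <= j)%N then p (j - i)%N else 0.
  elim: i j => [|i IH] j hi hj.
    rewrite subn0 /p; congr (D _ _).
    by apply/val_inj; rewrite /= inordK.
  rewrite step //; case: j hj => [|j] hj //=.
  by rewrite IH //; lia.
apply/matrixP=> i j; rewrite -[i in LHS]inord_val -[j in LHS]inord_val.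
rewrite pE // summxE.
under eq_bigr => k _ do rewrite mxE jblockXE mxE.
case: leqP => hij.
  have hk : (j - i < d'.+1)%N by have := ltn_ord j; lia.
  rewrite (bigD1 (Ordinal hk)) //= subnKC // eqxx mulr1 big1 ?addr0 // => k.
  rewrite -val_eqE /=; case: eqP => //.
  by case: eqP; rewrite ?mulr0 //; lia.
by rewrite big1 // => k _; case: eqP; rewrite ?mulr0 //; lia.
Qed.

Lemma sum_modn_eq h a r c : (c < h)%N -> (r < h)%N ->
  (\sum_(i < a * h + r) ((i : nat) %% h == c) = a + (c < r))%N.
Proof.
move=> hc hr; have block m : (m <= h)%N -> (\sum_(i < m) ((i : nat) %% h == c) = (c < m))%N.
  elim: m => [|m IH] hm; first by rewrite big_ord0.
  rewrite big_ord_recr /= IH ?modn_small //; lia.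
elim: a => [|a IH]; first by rewrite mul0n !add0n block // ltnW.
rewrite mulSn -addnA big_split_ord /= block // hc add1n addSn.
by under eq_bigr => i _ do rewrite modnDl; rewrite IH.
Qed.

Section Trace.
Hypothesis hK : 2%N \in [pchar K].

Lemma natr_pchar2 m : m%:R = (odd m)%:R :> K.
Proof.
by rewrite -{1}(odd_double_half m) natrD -mul2n natrM (pcharf0 hK) mul0r addr0.
Qed.

(* Y sends e_i to e_(i-k) for i in one residue class modulo h, chosen so that no
   chain of J^h is truncated by the ends of the block. *)
Lemma comm_jblock_trace d h k : (k < h)%N ->
  (~~ odd (d %/ h) && (k < d %% h) || odd (d %/ h) && (k < h - d %% h))%N ->
  exists Y : 'M[K]_d, GRing.comm Y (jblock d ^+ h) /\
    forall l, \tr (jblock d ^+ l * Y) = (l == k)%:R.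
Proof.
move=> hkh hyp; pose a := (d %/ h)%N; pose r := (d %% h)%N.
have hrh : (r < h)%N by rewrite ltn_mod; lia.
have dE : d = (a * h + r)%N by rewrite -divn_eq.
(* The trace of J^k Y counts the indices in [k, d) congruent to c, which is a + (c < r); either
   choice of c makes this odd. *)
pose c := (if odd a then h.-1 else k)%N.
have hck : (k <= c)%N by rewrite /c; case: ifP => _; lia.
have hch : (c < h)%N by rewrite /c; case: ifP => _; lia.
pose F i j : K := ((j + k == i) && (i %% h == c))%N%:R.
exists (\matrix_(i, j) F i j); split.
  rewrite /GRing.comm mul_Xjblock mul_jblockX; apply/matrixP=> i j; rewrite !mxE.
  rewrite /F modnDr; have hj := ltn_ord j; have hi := divn_eq i h.
  have [ic|] := eqVneq (i %% h)%N c; last by rewrite !andbF !if_same.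
  rewrite !andbT; have [e|ne] := eqVneq (j + k)%N (i + h)%N; last first.
    rewrite !if_same; case: leqP => // hhj; case: eqP => // e.
    by case/eqP: ne; lia.
  rewrite ic in hi; set t := (i %/ h)%N in hi.
  have -> : (h <= j)%N by lia.
  have -> : (j - h + k == i)%N by apply/eqP; lia.
  rewrite (_ : (i + h < d)%N) //.
  move: hyp hi; rewrite -/a -/r /c; case: (odd a) => /= hyp hi.
    have ta : (t + 2 <= a)%N.
      rewrite leqNgt; apply/negP=> ta.
      have H1 : ((a + 1) * h <= (t + 2) * h)%N by apply: leq_mul; lia.
      lia.
    have : ((t + 2) * h <= a * h)%N by rewrite leq_mul2r ta orbT.
    by lia.
  have ta : (t + 1 <= a)%N.
    rewrite leqNgt; apply/negP=> ta.
    have H1 : ((a + 1) * h <= (t + 1) * h)%N by apply: leq_mul; lia.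
    lia.
  have : ((t + 1) * h <= a * h)%N by rewrite leq_mul2r ta orbT.
  by lia.
have hkd : (k <= d)%N.
  move: hyp; rewrite -/a -/r dE; case: (a) => [|a']; first by rewrite /=; lia.
  by rewrite mulSn; lia.
have tr_k : (\sum_(k <= i < d) (i %% h == c) = a + (c < r))%N.
  rewrite -(sum_modn_eq a hch hrh) -dE -(big_mkord xpredT (fun i => (i %% h == c)%N : nat)).
  rewrite [RHS](big_cat_nat (n := k)) //=.
  rewrite [X in _ = (X + _)%N]big_nat_cond [X in _ = (X + _)%N]big1 // => i.
  by rewrite andbT => /= hi; rewrite modn_small; lia.
move=> l; rewrite mul_jblockX /mxtrace.
under eq_bigr => i _ do rewrite mxE /F eqn_add2l [k == l]eq_sym.
have [->|] := eqVneq l k; last by rewrite big1 // => i _; rewrite if_same.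
rewrite -(big_mkord xpredT (fun i => if (i + k < d)%N then
  (true && ((i + k) %% h == c))%N%:R else 0 : K)).
rewrite (big_cat_nat (n := d - k)) ?leq_subr //=.
rewrite [X in _ + X]big_nat_cond [X in _ + X]big1 ?addr0; last first.
  by move=> i; rewrite andbT; case: ifP => // ; lia.
transitivity ((\sum_(k <= i < d) (i %% h == c))%N%:R : K).
  rewrite -[in RHS](add0n k) big_addn natr_sum [LHS]big_nat_cond [RHS]big_nat_cond.
  by apply: eq_bigr => i; rewrite andbT => hi; rewrite ifT //; lia.
rewrite tr_k natr_pchar2 oddD oddb; move: hyp; rewrite -/a -/r /c.
by case: (odd a) => /= hyp; [rewrite ltnNge | ]; rewrite ?hyp ?orbF; congr _%:R; lia.
Qed.
End Trace.
End JordanBlock.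

(** * Preimages of powers of a Jordan block under ad^(q-1) *)

Lemma modn_lt2 q x : (x < q + q)%N -> (x %% q = if x < q then x else x - q)%N.
Proof.
move=> hx; case: ltnP => hq; first by rewrite modn_small.
by rewrite -[in LHS](subnK hq) modnDr modn_small; lia.
Qed.

Section Bands.
Variable K : fieldType.
Hypothesis hK : 2%N \in [pchar K].
(** The shift by e - (q - 1), cut down to the rows of one residue class modulo q. In the sum of J^l
    B J^(q-1-l), each row meets that class for exactly one l. The equation is additive because e may
    be less than q - 1. *)
Definition bandmx d q c e : 'M[K]_d :=
  \matrix_(i, j) (((i : nat) %% q == c) && (j + q.-1 == i + e))%N%:R.

(** For the row i = t q + p, l is the shift that takes i into the class c; the hypothesis says that
    this one term is not truncated at either border of the block. *)
Lemma adn_bandmx d k c e : let q := (2 ^ k)%N in (c < q)%N ->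
  (forall t p, (p < q -> t * q + p + e < d ->
    let l := if p <= c then c - p else c + q - p in
    t * q + p + l < d /\ q.-1 <= l + (t * q + p + e))%N) ->
  adn (jblock K d) q.-1 (bandmx d q c e) = jblock K d ^+ e.
Proof.
move=> q hcq H; have q_gt0 : (0 < q)%N by rewrite expn_gt0.
rewrite (adn_exp2_pred _ hK k) -/q jblockXE; clearbody q.
apply/matrixP=> i j; rewrite summxE mxE.
pose F (i j : nat) : K := ((i %% q == c) && (j + q.-1 == i + e))%N%:R.
have entry (l : 'I_q) :
    (jblock K d ^+ l * bandmx d q c e * jblock K d ^+ (q.-1 - l)) i j =
    ((j == i + e :> nat) &&
     [&& q.-1 - l <= j, i + l < d & (i + l) %% q == c])%N%:R.
  rewrite (@mul_jblockX K d _ F).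
  rewrite (@mul_Xjblock K d _ (fun i j => if (i + l < d)%N then F (i + l)%N j else 0)).
  rewrite mxE /F; case: (leqP (q.-1 - l) j) => h1; last by rewrite andbF.
  case: (ltnP (i + l) d) => h2; last by rewrite andbF.
  rewrite /= andbC; congr (_ && _)%:R.
  by apply/eqP/eqP; have := ltn_ord l; lia.
rewrite (eq_bigr _ (fun l _ => entry l)).
have [e_ij|] := eqVneq (j : nat) (i + e)%N; last by rewrite big1.
pose t := (i %/ q)%N; pose p := (i %% q)%N.
have hp : (p < q)%N by rewrite ltn_mod.
have iE : i = (t * q + p)%N :> nat by exact: divn_eq.
have := H t p hp; rewrite -iE -e_ij ltn_ord => /(_ isT) /=.
set l0 := (if _ then _ else _) => -[h1 h2].
have hl0 : (l0 < q)%N by rewrite /l0; case: (leqP p c); lia.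
have mod_l l : (l < q)%N -> ((i + l) %% q == c)%N = (l == l0).
  move=> hl; rewrite iE -addnA modnMDl modn_lt2; last by lia.
  by apply/eqP/eqP; rewrite /l0; case: (ltnP (p + l) q); case: (leqP p c); lia.
rewrite (bigD1 (Ordinal hl0)) //= mod_l // eqxx h1 big1 ?addr0.
  by rewrite (_ : q.-1 - l0 <= j)%N //; lia.
move=> l; rewrite -val_eqE /= mod_l // => /negPf ->.
by rewrite !andbF.
Qed.

(** A row i with i + d %% q < d lies in a complete run of q rows, and the last row of that run has
    residue q - 1. *)
Lemma jblockX_modn_adn d k : let q := (2 ^ k)%N in
  adn (jblock K d) q.-1 (bandmx d q q.-1 (d %% q)) = jblock K d ^+ (d %% q).
Proof.
move=> q; have q_gt0 : (0 < q)%N by rewrite expn_gt0.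
apply: adn_bandmx => [|t p]; first by rewrite -/q; lia.
rewrite -/q => hp; have := divn_eq d q; set a := (d %/ q)%N; set r := (d %% q)%N.
move=> dE hd; rewrite ifT; last by lia.
have ta : (t + 1 <= a)%N.
  rewrite leqNgt; apply/negP=> ta.
  have H1 : (a * q <= t * q)%N by apply: leq_mul; lia.
  lia.
have H1 : ((t + 1) * q <= a * q)%N by apply: leq_mul; lia.
by split; lia.
Qed.

(** The last row d - 1 belongs to the class chosen here, so every row is at or before some member of
    it. *)
Lemma jblockX_subn_adn d k : let q := (2 ^ k)%N in (0 < d %% q)%N ->
  adn (jblock K d) q.-1 (bandmx d q (d %% q).-1 (q - d %% q)) =
  jblock K d ^+ (q - d %% q).
Proof.
move=> q r_gt0; have q_gt0 : (0 < q)%N by rewrite expn_gt0.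
have hr : (d %% q < q)%N by rewrite ltn_mod.
apply: adn_bandmx => [|t p]; first by rewrite -/q; lia.
rewrite -/q => hp; have := divn_eq d q.
move: hr r_gt0; set a := (d %/ q)%N; set r := (d %% q)%N => hr r_gt0.
move=> dE hd; case: leqP => hpr.
  have ta : (t <= a)%N.
    rewrite leqNgt; apply/negP=> ta.
    have H1 : ((a + 1) * q <= t * q)%N by apply: leq_mul; lia.
    lia.
  have H1 : (t * q <= a * q)%N by apply: leq_mul; lia.
  by split; lia.
have ta : (t + 1 <= a)%N.
  rewrite leqNgt; apply/negP=> ta.
  have H1 : ((a + 1) * q <= (t + 1) * q)%N by apply: leq_mul; lia.
  lia.
have H1 : ((t + 1) * q <= a * q)%N by apply: leq_mul; lia.
by split; lia.
Qed.

(** The band has d / q nonzero entries, all on the subdiagonal q - 1, so only J^(q-1) brings it to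
    the diagonal. *)
Lemma mxtrace_bandmx d k l : let q := (2 ^ k)%N in (q %| d)%N ->
  \tr (jblock K d ^+ l * bandmx d q q.-1 0) =
  ((l == q.-1) && odd (d %/ q))%N%:R.
Proof.
move=> q /dvdnP [a ->]; have q_gt0 : (0 < q)%N by rewrite expn_gt0.
pose F (i j : nat) : K := ((i %% q == q.-1) && (j + q.-1 == i + 0))%N%:R.
rewrite (@mul_jblockX K _ _ F) /mxtrace.
under eq_bigr => i _ do rewrite mxE /F addn0 eqn_add2l [q.-1 == l]eq_sym.
have [->|] := eqVneq l q.-1; last first.
  by move=> _; rewrite big1 // => i _; rewrite andbF if_same.
transitivity ((\sum_(i < a * q) (i %% q == 0))%N%:R : K).
  rewrite natr_sum; apply: eq_bigr => i _; rewrite andbT.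
  have hi := divn_eq i q; have hp : (i %% q < q)%N by rewrite ltn_mod.
  have -> : ((i + q.-1) %% q == q.-1)%N = (i %% q == 0)%N.
    rewrite {1}hi -addnA modnMDl modn_lt2; last by lia.
    by apply/eqP/eqP; case: ltnP; lia.
  case: eqP => [p0|]; last by rewrite if_same.
  rewrite ifT //; have := ltn_ord i.
  have ta : (i %/ q + 1 <= a)%N.
    by rewrite addn1 ltn_divLR.
  have H1 : ((i %/ q + 1) * q <= a * q)%N by apply: leq_mul; lia.
  by lia.
have := sum_modn_eq a q_gt0 q_gt0; rewrite addn0 ltnn addn0 mulnK // => -> /=.
exact: natr_pchar2.
Qed.
End Bands.

(** * Vanishing of the trace pairing away from powers of 2 *)

Lemma modn_double q d : (d %% (q + q) = odd (d %/ q) * q + d %% q)%N.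
Proof.
case: (posnP q) => [->|q_gt0]; first by rewrite !modn0 muln0.
have hr : (d %% q < q)%N by rewrite ltn_mod.
rewrite {1}(divn_eq d q) -{1}(odd_double_half (d %/ q)) mulnDl -muln2 -mulnA.
rewrite mul2n -addnn addnAC addnC modnMDl modn_small //.
by case: (odd _); lia.
Qed.

Section Pairings.
Variable K : fieldType.
Hypothesis hK : 2%N \in [pchar K].
Lemma jblockX_adn d k e : let q := (2 ^ k)%N in
  (d %% q <= e)%N || (q - d %% q <= e)%N ->
  exists B, adn (jblock K d) q.-1 B = jblock K d ^+ e.
Proof.
move=> q he; have q_gt0 : (0 < q)%N by rewrite expn_gt0.
have lift c : (c <= e)%N -> (exists B, adn (jblock K d) q.-1 B = jblock K d ^+ c) ->
    exists B, adn (jblock K d) q.-1 B = jblock K d ^+ e.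
  move=> ce [B hB]; exists (jblock K d ^+ (e - c) * B).
  by rewrite adn_mull ?hB -?exprD ?subnK //; exact/commr_sym/commrX.
case: (leqP (d %% q) e) he => /= [he _|he1 he2].
  by apply: (lift _ he); exists (bandmx K d q q.-1 (d %% q)); exact: jblockX_modn_adn.
apply: (lift _ he2); exists (bandmx K d q (d %% q).-1 (q - d %% q)).
by apply: jblockX_subn_adn => //; apply: leq_ltn_trans he1.
Qed.

Section Pairing.
Variables (n : nat) (z : 'M[K]_n).

Lemma mxtrace_adn_im l m A B : adn z m A = 0 -> \tr (z ^+ l * adn z m B * A) = 0.
Proof.
move=> hA; rewrite -adn_mull; last exact/commr_sym/commrX.
by rewrite mxtrace_adn hA mulr0 mxtrace0.
Qed.

(** Both [adn z m A] and [adn z m B] commute with z, so z^l can be moved past before ad^m is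
    transposed. Cross terms therefore cancel in pairs, and the form is additive. *)
Lemma mxtrace_adn_sym l m A B : adn z m.+1 A = 0 -> adn z m.+1 B = 0 ->
  \tr (z ^+ l * adn z m A * B) = \tr (z ^+ l * adn z m B * A).
Proof.
move=> hA hB; have cA := adn_last_comm hK hA; have cB := adn_last_comm hK hB.
rewrite -(commrX l cA) -mulrA mxtrace_adn adn_mull ?(commrX _ _) //; last first.
  exact/commr_sym/commrX.
by rewrite mxtrace_mulC.
Qed.

Lemma mxtrace_adn_additive l m A B : adn z m.+1 A = 0 -> adn z m.+1 B = 0 ->
  \tr (z ^+ l * adn z m (A + B) * (A + B)) =
  \tr (z ^+ l * adn z m A * A) + \tr (z ^+ l * adn z m B * B).
Proof.
move=> hA hB; rewrite linearD /= !mulrDr !mulrDl !raddfD /=.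
rewrite (mxtrace_adn_sym l hB hA) -addrA [X in _ + X]addrA.
by rewrite (addrr_pchar2 hK) add0r.
Qed.

(* The form is additive, and the parts p A p' and p' A p pair to zero with
   themselves. *)
Lemma mxtrace_adn_split l m A (p p' : 'M[K]_n) : GRing.comm p z ->
  p * p = p -> p + p' = 1 -> adn z m.+1 A = 0 ->
  \tr (z ^+ l * adn z m A * A) =
  \tr (z ^+ l * adn z m (p * A * p) * (p * A * p)) +
  \tr (z ^+ l * adn z m (p' * A * p') * (p' * A * p')).
Proof.
move=> cp pp pp' hA; have p'E : p' = 1 - p by rewrite -pp' addrAC subrr add0r.
have cp' : GRing.comm p' z by rewrite p'E; exact/commr_sym/commrB/commr_sym/cp/commr1.
have adnE r r' k : GRing.comm r z -> GRing.comm r' z ->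
    adn z k (r * A * r') = r * adn z k A * r'.
  by move=> c c'; rewrite adn_mulr // adn_mull.
have ker r r' : GRing.comm r z -> GRing.comm r' z -> adn z m.+1 (r * A * r') = 0.
  by move=> c c'; rewrite adnE // hA mulr0 mul0r.
have kerD B C : adn z m.+1 B = 0 -> adn z m.+1 C = 0 -> adn z m.+1 (B + C) = 0.
  by move=> hB hC; rewrite linearD /= hB hC addr0.
have zero r r' : GRing.comm r z -> GRing.comm r' z -> r' * r = 0 ->
    \tr (z ^+ l * adn z m (r * A * r') * (r * A * r')) = 0.
  move=> c c' rr; rewrite adnE // !mulrA -[_ * r' * r]mulrA rr mulr0 !mul0r.
  by rewrite mxtrace0.
have p'p : p' * p = 0 by rewrite p'E mulrBl mul1r pp subrr.
have pp'0 : p * p' = 0 by rewrite p'E mulrBr mulr1 pp subrr.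
have AE : A = (p * A * p + p' * A * p') + (p * A * p' + p' * A * p).
  rewrite -[LHS]mul1r -[LHS]mulr1 -pp' !mulrDl !mulrDr.
  by rewrite [X in _ + X]addrC addrACA.
rewrite {1 2}AE !mxtrace_adn_additive ?kerD ?ker //.
by rewrite (zero p p') // (zero p' p) // !addr0.
Qed.

End Pairing.

(** D = ad^(m-1) A commutes with J, hence is a polynomial in J. As m - 1 >= h, D is in the image of
    ad^h and so orthogonal to everything commuting with J^h; this kills the coefficients of J^k for
    k below both r and 2h - r, where r = d mod 2h. The remaining powers of J lie in the image of
    ad^(2h-1), hence of ad^m, which is orthogonal to A. *)
Lemma jblock_pairing0 d b m l A : (2 ^ b < m < 2 ^ b.+1)%N ->
  adn (jblock K d) m A = 0 ->
  \tr (jblock K d ^+ l * adn (jblock K d) m.-1 A * A) = 0.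
Proof.
pose h := (2 ^ b)%N; rewrite -/h expnS mul2n -addnn => /andP[hm mq] hA.
set J := jblock K d in hA *; set D := adn J m.-1 A.
have h_gt0 : (0 < h)%N by rewrite expn_gt0.
have cD : GRing.comm D J by apply: adn_last_comm => //; rewrite prednK //; lia.
have [p pE] := comm_jblock_sum cD.
have DE : D = adn J h (adn J (m.-1 - h) A) by rewrite -adnD subnKC //; lia.
have p0 k : (k < d)%N -> (k < d %% (h + h))%N -> (k < h + h - d %% (h + h))%N ->
    p k = 0.
  move=> kd; rewrite modn_double => k1 k2.
  have [| |Y [cY tY]] := @comm_jblock_trace K hK d h k.
  - by have : (d %% h < h)%N by [rewrite ltn_mod]; move: k1 k2; case: (odd _); lia.
  - by move: k1 k2; case: (odd _); lia.
  (* By the choice of Y this trace is the coefficient p k. *)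
  have : \tr (D * Y) = 0.
    rewrite DE mxtrace_adn (_ : adn J h Y = 0) ?mulr0 ?mxtrace0 //.
    exact/adn_exp2_eq0.
  rewrite pE mulr_suml raddf_sum (bigD1 (Ordinal kd)) //= big1 ?addr0.
    by rewrite -mulmxE -scalemxAl mulmxE mxtraceZ tY eqxx mulr1.
  move=> i; rewrite -val_eqE /= => /negPf ne.
  by rewrite -mulmxE -scalemxAl mulmxE mxtraceZ tY ne mulr0.
suff [B hB] : exists B, D = adn J (h + h).-1 B.
  rewrite hB (_ : (h + h).-1 = m + ((h + h).-1 - m))%N ?adnD; last by lia.
  exact: mxtrace_adn_im.
have [B hB] : exists B, forall k : 'I_d, p k *: J ^+ k = adn J (h + h).-1 (B k).
  (* The threshold c separates the coefficients already known to vanish from the powers that are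
     images of bands. *)
  pose c := minn (d %% (h + h)) (h + h - d %% (h + h)).
  have [|C hC] := @jblockX_adn d b.+1 c.
    by rewrite expnS mul2n -addnn -/h /c; lia.
  move: hC; rewrite expnS mul2n -addnn -/h => hC.
  exists (fun k => p k *: (J ^+ (k - c) * C)) => k.
  rewrite linearZ /= adn_mull; last exact/commr_sym/commrX.
  rewrite hC -exprD; case: (leqP c k) => ck; first by rewrite subnK.
  by rewrite p0 ?scale0r //; have := ltn_ord k; lia.
by exists (\sum_k B k); rewrite pE linear_sum; apply: eq_bigr => k _; rewrite hB.
Qed.
End Pairings.

(** * Direct sums of Jordan blocks *)

Section JordanNil.
Variable K : fieldType.

Lemma jordan_nil_cons d s :
  jordan_nil K (d :: s) = block_mx (jblock K d) 0 0 (jordan_nil K s).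
Proof.
(* The [scanl] lists where blocks start; the starts in the tail are moved by d. *)
have sc k t : scanl addn (d + k)%N t = map (addn d) (scanl addn k t).
  by elim: t k => //= x t IH k; rewrite -addnA IH.
have scE : scanl addn 0%N (d :: s) = d :: map (addn d) (scanl addn 0%N s).
  by rewrite /= add0n -sc addn0.
apply/matrixP=> i j; rewrite -[i](splitK i) -[j](splitK j).
case: (split i) => i'; case: (split j) => j' /=.
- rewrite block_mxEul !mxE scE /= inE negb_or.
  case: eqP => //= _; have := ltn_ord j'.
  rewrite neq_ltn => -> /=; rewrite (_ : (j' : nat) \notin _) //.
  by apply/mapP=> -[y _ jE]; have := ltn_ord j'; lia.
- rewrite block_mxEur !mxE scE /= inE negb_or; case: eqP => //= e.
  by have := ltn_ord i'; case: eqP => //; lia.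
- rewrite block_mxEdl !mxE /=; case: eqP => //= e.
  by have := ltn_ord j'; lia.
- rewrite block_mxEdr !mxE scE /= inE negb_or -addnS eqn_add2l.
  case: eqP => //= e; rewrite mem_map; last exact: addnI.
  by rewrite e; case: eqP => //; lia.
Qed.

Section BlockDiag.
Variables (n1 n2 : nat) (z1 : 'M[K]_n1) (z2 : 'M[K]_n2).

Lemma adn_block_diag m A1 A2 :
  adn (block_mx z1 0 0 z2) m (block_mx A1 0 0 A2) =
  block_mx (adn z1 m A1) 0 0 (adn z2 m A2).
Proof.
elim: m => // m IH; rewrite !adnS IH -!mulmxE !mulmx_block.
by rewrite !(mul0mx, mulmx0, addr0, add0r) add_block_mx !addr0.
Qed.

Lemma expr_block_diag m :
  block_mx z1 0 0 z2 ^+ m = block_mx (z1 ^+ m) 0 0 (z2 ^+ m).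
Proof.
elim: m => [|m IH]; first by rewrite !expr0 -scalar_mx_block.
by rewrite !exprS IH -!mulmxE mulmx_block !(mul0mx, mulmx0, addr0, add0r).
Qed.

Lemma mul_block_diag A1 A2 B1 B2 :
  block_mx A1 0 0 A2 * block_mx B1 0 0 B2 =
  block_mx (A1 * B1) 0 0 (A2 * B2) :> 'M[K]_(n1 + n2).
Proof. by rewrite -!mulmxE mulmx_block !(mul0mx, mulmx0, addr0, add0r). Qed.

End BlockDiag.

Hypothesis hK : 2%N \in [pchar K].

Lemma jordan_nilX_adn s k e : let q := (2 ^ k)%N in
  all (fun d => (d %% q <= e) || (q - d %% q <= e))%N s ->
  exists B, adn (jordan_nil K s) q.-1 B = jordan_nil K s ^+ e.
Proof.
move=> q; elim: s => [|d s IH] /=; first by exists 0; apply/matrixP=> -[].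
move=> /andP[/(jblockX_adn hK) [B1 hB1] /IH [B2 hB2]].
exists (block_mx B1 0 0 B2); rewrite jordan_nil_cons adn_block_diag hB1 hB2.
by rewrite expr_block_diag.
Qed.

(** The bands with e = 0 of all blocks together give a preimage of the identity, and the parities of
    the d / q add up. *)
Lemma jordan_nil1_adn s k : let q := (2 ^ k)%N in all (dvdn q) s ->
  exists B, adn (jordan_nil K s) q.-1 B = 1 /\
    forall l, \tr (jordan_nil K s ^+ l * B) = ((l == q.-1) && odd (sumn s %/ q))%:R.
Proof.
move=> q; elim: s => [|d s IH] /=.
  exists 0; split=> [|l]; first by apply/matrixP=> -[].
  by rewrite mulr0 mxtrace0 div0n andbF.
move=> /andP[hd /IH [B2 [hB2 tB2]]].
exists (block_mx (bandmx K d q q.-1 0) 0 0 B2).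
rewrite jordan_nil_cons adn_block_diag hB2; split=> [|l].
  have := jblockX_modn_adn hK d k; rewrite /= -/q (eqP hd) => ->.
  by rewrite -scalar_mx_block.
rewrite expr_block_diag mul_block_diag mxtrace_block tB2 mxtrace_bandmx //.
rewrite divnDl // oddD; case: eqP => _ /=; last by rewrite addr0.
by rewrite -natrD natr_pchar2 // oddD !oddb.
Qed.

Lemma comm_jordan_nil_trace s d h k : d \in s -> (k < h)%N ->
  (~~ odd (d %/ h) && (k < d %% h) || odd (d %/ h) && (k < h - d %% h))%N ->
  exists Y, GRing.comm Y (jordan_nil K s ^+ h) /\
    forall l, \tr (jordan_nil K s ^+ l * Y) = (l == k)%:R.
Proof.
move=> + hk hyp; elim: s => // d' s IH; rewrite inE => /predU1P[<-|/IH [Y [cY tY]]].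
  have [Y [cY tY]] := comm_jblock_trace hK hk hyp.
  exists (block_mx Y 0 0 0); rewrite jordan_nil_cons; split=> [|l].
    by rewrite /GRing.comm expr_block_diag !mul_block_diag cY mulr0 mul0r.
  by rewrite expr_block_diag mul_block_diag mxtrace_block tY mulr0 mxtrace0 addr0.
exists (block_mx 0 0 0 Y); rewrite jordan_nil_cons; split=> [|l].
  by rewrite /GRing.comm expr_block_diag !mul_block_diag cY mulr0 mul0r.
by rewrite expr_block_diag mul_block_diag mxtrace_block tY mulr0 mxtrace0 add0r.
Qed.

Lemma jordan_nil_pairing0 s b m l A : (2 ^ b < m < 2 ^ b.+1)%N ->
  adn (jordan_nil K s) m A = 0 ->
  \tr (jordan_nil K s ^+ l * adn (jordan_nil K s) m.-1 A * A) = 0.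
Proof.
move=> hm; elim: s A => [|d s IH] A; first by rewrite /mxtrace big_ord0.
rewrite jordan_nil_cons.
have m_gt0 : (0 < m)%N by case/andP: hm => /(leq_ltn_trans _) ->.
rewrite -(prednK m_gt0); set z := block_mx _ _ _ _ => hA.
(* The projections onto the first block and onto the rest commute with z, so the pairing splits
   along them. *)
pose p : 'M[K]_(d + sumn s) := block_mx 1%:M 0 0 0.
pose p' : 'M[K]_(d + sumn s) := block_mx 0 0 0 1%:M.
have cp : GRing.comm p z.
  by rewrite /GRing.comm /p !mul_block_diag mulr1 mul1r mulr0 mul0r.
rewrite (mxtrace_adn_split hK l cp _ _ hA (p' := p')); first last.
- by rewrite add_block_mx !addr0 add0r -scalar_mx_block.
- by rewrite mul_block_diag mulr1 mulr0.
have pA : p * A * p = block_mx (ulsubmx A) 0 0 0.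
  rewrite -{1}[A]submxK -!mulmxE !mulmx_block.
  by rewrite !(mul0mx, mulmx0, mul1mx, mulmx1, addr0, add0r).
have p'A : p' * A * p' = block_mx 0 0 0 (drsubmx A).
  rewrite -{1}[A]submxK -!mulmxE !mulmx_block.
  by rewrite !(mul0mx, mulmx0, mul1mx, mulmx1, addr0, add0r).
have cp' : GRing.comm p' z.
  by rewrite /GRing.comm /p' !mul_block_diag mulr1 mul1r mulr0 mul0r.
have h1 : adn z m.-1.+1 (p * A * p) = 0 by rewrite adn_mulr // adn_mull // hA mulr0 mul0r.
have h2 : adn z m.-1.+1 (p' * A * p') = 0.
  by rewrite adn_mulr // adn_mull // hA mulr0 mul0r.
rewrite pA adn_block_diag in h1; rewrite p'A adn_block_diag in h2.
rewrite pA p'A !adn_block_diag !expr_block_diag !mul_block_diag !mxtrace_block.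
rewrite !mulr0 !mxtrace0.
rewrite -block_mx0 in h1 h2; have [{}h1 _ _ _] := eq_block_mx h1.
have [_ _ _ {}h2] := eq_block_mx h2.
rewrite (prednK m_gt0) in h1 h2.
by rewrite (jblock_pairing0 hK l hm h1) (IH _ h2) addr0 add0r.
Qed.
End JordanNil.

(** * Consecutive-ones expansions *)

Section ConsecutiveOnes.
Local Open Scope nat_scope.

Local Notation gtn_sorted := (sorted (fun a b => b < a)).

Lemma gtn_trans : transitive (fun a b => b < a).
Proof. by move=> y x z /[swap]; apply: ltn_trans. Qed.

Lemma gtn_sorted_cons a t : gtn_sorted (a :: t) = all (fun b => b < a) t && gtn_sorted t.
Proof. exact: path_sortedE gtn_trans a t. Qed.

(* The minimal expansions are those not ending in + 2^(b+1) - 2^b or its negative. *)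
Fixpoint reduced (es : seq nat) : bool :=
  match es with
  | [::] => true
  | [:: a; b] => b.+1 != a
  | _ :: es' => reduced es'
  end.

(* Truncated subtraction: this is alt_val only on reduced expansions. *)
Fixpoint aval (es : seq nat) : nat :=
  if es is e :: es' then 2 ^ e - aval es' else 0.

Lemma reduced_behead a t : reduced (a :: t) -> reduced t.
Proof. by case: t => [|b [|c t]]. Qed.

(** A one-term tail is below half of 2^a by reducedness, a longer one because its own tail is
    positive. Hence the subtraction in [aval] never truncates. *)
Lemma aval_bound a t : gtn_sorted (a :: t) -> reduced (a :: t) ->
  2 * aval t < 2 ^ a /\ (t != [::] -> 0 < aval t).
Proof.
elim: t a => [|c t IH] a; first by rewrite muln0 expn_gt0.
move=> + red; rewrite gtn_sorted_cons => /andP[/andP[ca _] sct].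
have [bt pt] := IH c sct (reduced_behead red).
split; last by move=> _; rewrite /=; lia.
clear IH; case: t => [|e t] in red bt pt sct *.
  rewrite /= subn0 -expnS ltn_exp2l // ltn_neqAle ca andbT; exact: red.
have := pt isT; have : 2 * 2 ^ c <= 2 ^ a by rewrite -expnS leq_pexp2l.
by rewrite /=; lia.
Qed.

Lemma aval_le_head a t : aval (a :: t) <= 2 ^ a.
Proof. exact: leq_subr. Qed.

Lemma alt_valE es : gtn_sorted es -> reduced es -> alt_val es = (aval es)%:Z.
Proof.
elim: es => // a t IH sat red; have [bt _] := aval_bound sat red.
move: sat; rewrite gtn_sorted_cons => /andP[_ st].
by rewrite /= IH ?(reduced_behead red) // -subzn //; lia.
Qed.

(** The open interval from h to 3h is stable under negation modulo 4h. *)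
Lemma window_opp h m m' : 4 * h %| m + m' ->
  (h < m %% (4 * h) < 3 * h) = (h < m' %% (4 * h) < 3 * h).
Proof.
case: (posnP h) => [->|h0]; first by rewrite !muln0 !ltn0 !andbF.
have r1 : m %% (4 * h) < 4 * h by rewrite ltn_mod muln_gt0.
have r2 : m' %% (4 * h) < 4 * h by rewrite ltn_mod muln_gt0.
rewrite /dvdn -modnDm modn_lt2; last by lia.
by case: ltnP => ? /eqP ?; lia.
Qed.

(** Put h = 2^b. A leading power above 2h vanishes modulo 4h and leaves minus the tail; 2h minus a
    tail below h lies in the window; a leading power of at most h gives a value of at most h. *)
Lemma mem_reduced es b : gtn_sorted es -> reduced es ->
  (b.+1 \in es) = (2 ^ b < aval es %% (4 * 2 ^ b) < 3 * 2 ^ b).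
Proof.
elim: es => [|a t IH] sat red; first by rewrite in_nil mod0n ltn0.
have [bt _] := aval_bound sat red.
move: sat; rewrite gtn_sorted_cons => /andP[tlt st].
have h0 : 0 < 2 ^ b by rewrite expn_gt0.
have E4 : 4 * 2 ^ b = 2 ^ b.+2 by rewrite !expnS mulnA.
rewrite inE; case: (ltngtP b.+1 a) => /= ba.
- rewrite IH ?(reduced_behead red) //; apply: window_opp.
  by rewrite subnKC ?E4 ?dvdn_exp2l //; lia.
- have -> : (b.+1 \in t) = false.
    by apply/negP=> /(allP tlt); lia.
  have := aval_le_head a t; rewrite /= => H.
  have H' : 2 ^ a <= 2 ^ b by rewrite leq_pexp2l.
  by rewrite modn_small; lia.
- rewrite -ba expnS in bt *; rewrite modn_small; lia.
Qed.

Lemma odd_aval es : gtn_sorted es -> reduced es -> odd (aval es) = (0 \in es).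
Proof.
elim: es => // a t IH sat red; have [bt _] := aval_bound sat red.
move: sat; rewrite gtn_sorted_cons => /andP[tlt st].
rewrite /= inE oddB; last by lia.
rewrite -IH ?(reduced_behead red) //.
case: a bt {red tlt} => [|a] bt; last by rewrite oddX.
by rewrite (_ : aval t = 0) //; lia.
Qed.

(** The value decides which exponents occur, by its parity for 0 and by a window for b + 1, and a
    decreasing list is determined by its members. *)
Lemma reduced_uniq es es' : gtn_sorted es -> reduced es ->
  gtn_sorted es' -> reduced es' -> aval es = aval es' -> es = es'.
Proof.
move=> s r s' r' e; apply: (irr_sorted_eq gtn_trans) => // [x|]; first exact: ltnn.
by move=> [|b]; [rewrite -!odd_aval // e | rewrite !mem_reduced // e].
Qed.

Lemma exists_reduced m : exists es, [/\ gtn_sorted es, reduced es & aval es = m].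
Proof.
have [k] := ubnP m; elim: k m => // k IH m; rewrite ltnS => mk.
case: (posnP m) => [->|m0]; first by exists [::].
(* The leading term is the least power of 2 not below m. That 2^a < 2m makes 2^a - m smaller than m,
   and also makes the result decreasing and reduced. *)
have [a [am ma]] : exists a, m <= 2 ^ a /\ 2 ^ a < 2 * m.
  exists (up_log 2 m); rewrite up_logP //; split=> //.
  case: (leqP m 1) => [m1|m1]; first by rewrite (_ : m = 1) ?up_log1; lia.
  have := @up_log_gtn 2 m isT m1; have := up_log_gt0 2 m.
  by rewrite m1 /=; case: (up_log 2 m) => // a _; rewrite expnS /=; lia.
have [|t [st rt tE]] := IH (2 ^ a - m); first by lia.
exists (a :: t); split; last by rewrite /= tE; lia.
- rewrite gtn_sorted_cons st andbT.
  case: t => [|c t] // in st rt tE *; have [bt _] := aval_bound st rt.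
  have ca : c < a by rewrite -(@ltn_exp2l 2) //; move: tE; rewrite /=; lia.
  rewrite /= ca; move: st; rewrite gtn_sorted_cons => /andP[+ _].
  by apply: sub_all => x /ltn_trans; apply.
- case: t => [|c [|c' t]] // in st rt tE *.
  rewrite /= neq_ltn -(@ltn_exp2l 2 c.+1) // expnS.
  by move: tE; rewrite /= subn0; lia.
Qed.

(** An ending 2^(c+1) - 2^c merges into 2^c, which shortens the list. The bound B guarantees in the
    induction that the exponent in front still dominates. *)
Lemma exists_reduction es B : gtn_sorted es -> all (fun e => e < B) es ->
  exists es', [/\ gtn_sorted es', reduced es', all (fun e => e < B) es',
    alt_val es' = alt_val es & es' = es \/ size es' < size es].
Proof.
elim: es B => [|a t IH] B; first by exists [::]; split=> //; left.
rewrite gtn_sorted_cons => /andP[tlt st] /= /andP[aB _].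
have [t' [st' rt' tlt' alt' et]] := IH a st tlt.
have sat' : gtn_sorted (a :: t') by rewrite gtn_sorted_cons tlt'.
have aB' : all (fun e => e < B) (a :: t').
  by rewrite /= aB; apply: sub_all tlt' => x /ltn_trans; apply.
have [red|nred] := boolP (reduced (a :: t')).
  exists (a :: t'); split=> //=; first by rewrite alt'.
  by case: et => [->|]; [left | right].
case: t' => [|c [|c' t']] // in st' rt' tlt' alt' et sat' aB' nred *; last first.
  by case/negP: nred; exact: rt'.
move: nred; rewrite negbK => /eqP ca.
exists [:: c]; split=> //=; first by case/and3P: aB' => _ ->.
  rewrite -alt' -ca /= !GRing.subr0 expnS mul2n -addnn PoszD.
  by rewrite GRing.addrK.
by right; case: et => [<-|/=] //; lia.
Qed.

(** Minimal expansions are the reduced ones: a minimal one cannot be shortened, so it equals its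
    reduction, and every expansion of m reduces to the unique reduced one without growing. *)
Lemma occurs_cob_window b m :
  occurs_cob b.+1 m <-> 2 ^ b < m %% (4 * 2 ^ b) < 3 * 2 ^ b.
Proof.
have bounded (s : seq nat) : exists B, all (fun e => e < B) s.
  exists (\max_(e <- s) e).+1; apply/allP=> e es.
  by rewrite ltnS; apply: (leq_bigmax_seq (F := id)) es isT.
split=> [[es [[s es_m] min bes]]|W].
  have [B hB] := bounded es.
  have [es' [s' r' _ alt' [e|lt]]] := exists_reduction s hB; last first.
    have /min : cob_expansion es' m by split; rewrite ?alt'.
    by rewrite leqNgt lt.
  rewrite e in r'; rewrite mem_reduced // in bes.
  by have := alt_valE s r'; rewrite es_m => -[->].
have [es [s r esm]] := exists_reduced m.
exists es; split; [|move=> es' [s' es'm]|by rewrite mem_reduced // esm].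
  by split=> //; rewrite alt_valE // esm.
have [B hB] := bounded es'.
have [es2 [s2 r2 _ alt2 le2]] := exists_reduction s' hB.
have <- : es2 = es.
  apply: reduced_uniq => //; rewrite esm; apply/eqP; rewrite -eqz_nat -alt_valE //.
  by rewrite alt2 es'm.
by case: le2 => [->|/ltnW].
Qed.

End ConsecutiveOnes.

(** * Transport to the Jordan form *)

Section Similarity.
Variables (K : fieldType) (N n : nat) (J : 'M[K]_N) (z : 'M[K]_n).
Variables (phi : 'M[K]_(N, n)) (psi : 'M[K]_(n, N)).
Hypotheses (phiK : phi *m psi = 1%:M) (psiK : psi *m phi = 1%:M).
Hypothesis phiJ : J *m phi = phi *m z.

(** Conjugation through rectangular matrices, since [sumn s] and n are equal but not convertible. *)
Definition simmx (A : 'M[K]_N) : 'M[K]_n := psi *m A *m phi.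

Lemma simmxM A B : simmx (A * B) = simmx A * simmx B.
Proof. by rewrite /simmx -!mulmxE !mulmxA -[_ *m phi *m psi]mulmxA phiK mulmx1. Qed.

Lemma simmxD A B : simmx (A + B) = simmx A + simmx B.
Proof. by rewrite /simmx mulmxDr mulmxDl. Qed.

Lemma simmx0 : simmx 0 = 0. Proof. by rewrite /simmx mulmx0 mul0mx. Qed.

Lemma simmx1 : simmx 1 = 1.
Proof. by rewrite /simmx mulmx1 psiK. Qed.

Lemma simmxJ : simmx J = z.
Proof. by rewrite /simmx -mulmxA phiJ mulmxA psiK mul1mx. Qed.

Lemma simmxX m : simmx (J ^+ m) = z ^+ m.
Proof. by elim: m => [|m IH]; rewrite ?simmx1 // !exprS simmxM simmxJ IH. Qed.

Lemma adn_simmx m A : adn z m (simmx A) = simmx (adn J m A).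
Proof. by elim: m => // m IH; rewrite !adnS IH simmxD !simmxM simmxJ. Qed.

Lemma mxtrace_simmx A : \tr (simmx A) = \tr A.
Proof. by rewrite /simmx -mulmxA mxtrace_mulC -mulmxA phiK mulmx1. Qed.

Lemma simmxK A : simmx (phi *m A *m psi) = A.
Proof. by rewrite /simmx !mulmxA psiK mul1mx -mulmxA psiK mulmx1. Qed.

Lemma simmx_inj : injective simmx.
Proof.
move=> A B /(congr1 (fun C => phi *m C *m psi)).
by rewrite /simmx !mulmxA phiK !mul1mx -!mulmxA phiK !mulmx1.
Qed.

End Similarity.

Lemma jordan_isoP (K : fieldType) n (z : 'M[K]_n) s :
  jordan_iso z (1%:M : 'M[K]_n) (0 : 'M[K]_(1, n)) s ->
  sumn s = n /\ exists (phi : 'M[K]_(sumn s, n)) (psi : 'M[K]_(n, sumn s)),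
    [/\ phi *m psi = 1%:M, psi *m phi = 1%:M & jordan_nil K s *m phi = phi *m z].
Proof.
case=> phi [_ full free /submx0null/eqP]; rewrite subr_eq0 => /eqP phiJ.
have {}full : row_full phi by rewrite -sub1mx; move: full; rewrite addsmx0.
have {}free : row_free phi.
  by apply/inj_row_free => w hw; apply: free; rewrite hw sub0mx.
split; first by rewrite -(eqP full) -[LHS](eqP free).
have [psi psiK] := row_fullP full; have [psi' phiK] := row_freeP free.
exists phi, psi; split=> //.
have -> : psi = psi' by rewrite -[LHS]mulmx1 -phiK mulmxA psiK mul1mx.
exact: phiK.
Qed.

Section JordanForm.
Variables (K : fieldType) (n : nat) (z : 'M[K]_n) (s : seq nat).
Hypothesis hK : 2%N \in [pchar K].
Hypothesis zJ : jordan_iso z (1%:M : 'M[K]_n) (0 : 'M[K]_(1, n)) s.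

Lemma jordan_formX_adn k e : let q := (2 ^ k)%N in
  all (fun d => (d %% q <= e) || (q - d %% q <= e))%N s ->
  exists B, adn z q.-1 B = z ^+ e.
Proof.
move=> q /(jordan_nilX_adn hK) [B hB].
have [_ [phi [psi [h1 h2 h3]]]] := jordan_isoP zJ.
exists (simmx phi psi B).
by rewrite (adn_simmx h1 h2 h3) hB (simmxX h1 h2 h3).
Qed.

Lemma jordan_form1_adn k : let q := (2 ^ k)%N in all (dvdn q) s ->
  exists B, adn z q.-1 B = 1 /\
    forall l, \tr (z ^+ l * B) = ((l == q.-1) && odd (n %/ q))%:R.
Proof.
move=> q /(jordan_nil1_adn hK) [B [hB tB]].
have [sn [phi [psi [h1 h2 h3]]]] := jordan_isoP zJ.
exists (simmx phi psi B); split=> [|l].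
  by rewrite (adn_simmx h1 h2 h3) hB (simmx1 h2).
by rewrite -(simmxX h1 h2 h3) -(simmxM h1) (mxtrace_simmx h1) tB sn.
Qed.

Lemma comm_jordan_form_trace d h k : d \in s -> (k < h)%N ->
  (~~ odd (d %/ h) && (k < d %% h) || odd (d %/ h) && (k < h - d %% h))%N ->
  exists Y, GRing.comm Y (z ^+ h) /\ forall l, \tr (z ^+ l * Y) = (l == k)%:R.
Proof.
move=> ds hk /(comm_jordan_nil_trace hK ds hk) [Y [cY tY]].
have [sn [phi [psi [h1 h2 h3]]]] := jordan_isoP zJ.
exists (simmx phi psi Y); split=> [|l].
  by rewrite /GRing.comm -(simmxX h1 h2 h3) -!(simmxM h1) cY.
by rewrite -(simmxX h1 h2 h3) -(simmxM h1) (mxtrace_simmx h1) tY.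
Qed.

Lemma jordan_form_pairing0 b m l A : (2 ^ b < m < 2 ^ b.+1)%N ->
  adn z m A = 0 -> \tr (z ^+ l * adn z m.-1 A * A) = 0.
Proof.
have [sn [phi [psi [h1 h2 h3]]]] := jordan_isoP zJ.
rewrite -(simmxK h2 A) !(adn_simmx h1 h2 h3) => hm hA.
rewrite -(simmxX h1 h2 h3) -!(simmxM h1) (mxtrace_simmx h1).
apply: jordan_nil_pairing0 hm _ => //.
by apply: (simmx_inj h1); rewrite hA simmx0.
Qed.

End JordanForm.

(** * The forms b_V(X^(d-1) A, A) *)

Section Unipotent.
Variables (K : fieldType) (n : nat) (u : 'M[K]_n).
Hypotheses (hK : 2%N \in [pchar K]) (u_unit : u \in unitmx).
Local Notation z := (u - 1%:M).
Local Notation w := (invmx u).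
Hypothesis z_nilp : z ^+ n = 0.

(** Iterating the trace-of-square formula, a 2-power of the trace of M is the trace of a vanishing
    power of M. *)
Lemma mxtrace_nilp (M : 'M[K]_n) m : M ^+ m = 0 -> \tr M = 0.
Proof.
move=> hM; have trX k : \tr (M ^+ (2 ^ k)) = \tr M ^+ (2 ^ k).
  elim: k => [|k IH]; first by rewrite !expr1.
  by rewrite expnS mul2n -addnn !exprD mxtrace_sqr // IH expr2.
apply/eqP; have := expf_eq0 (\tr M) (2 ^ m); rewrite expn_gt0 /= => <-.
by rewrite -trX -(subnK (ltnW (ltn_expl m (ltnSn 1)))) exprD hM mulr0 mxtrace0.
Qed.

Lemma mxtrace_mul_nilp m M : (0 < m)%N -> GRing.comm M (z ^+ m) ->
  \tr (z ^+ m * M) = 0.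
Proof.
move=> m0 cM; apply: (@mxtrace_nilp _ n).
rewrite exprMn_comm ?(commr_sym cM) // -exprM.
by rewrite -(prednK m0) mulSn exprD z_nilp !mul0r.
Qed.

Lemma unipE : u = 1 + z.
Proof. by rewrite addrC subrK. Qed.

Lemma mul_inv_unip : w * u = 1. Proof. exact: mulVmx. Qed.
Lemma mul_unip_inv : u * w = 1. Proof. exact: mulmxV. Qed.

Lemma comm_uz : GRing.comm u z.
Proof. by apply: commrB => //; exact: commr1. Qed.

Lemma comm_inv (M U V : 'M[K]_n) : V * U = 1 -> U * V = 1 ->
  GRing.comm M U -> GRing.comm M V.
Proof.
move=> VU UV cM; rewrite /GRing.comm -[LHS]mul1r -VU -!mulrA; congr (_ * _).
by rewrite mulrA -cM -mulrA UV mulr1.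
Qed.

Lemma comm_wz : GRing.comm w z.
Proof. exact/commr_sym/(comm_inv mul_inv_unip mul_unip_inv)/commr_sym/comm_uz. Qed.

Lemma mul_wX_uX m : w ^+ m * u ^+ m = 1.
Proof.
rewrite -exprMn_comm ?mul_inv_unip ?expr1n //.
by rewrite /GRing.comm mul_inv_unip mul_unip_inv.
Qed.

Lemma mul_uX_wX m : u ^+ m * w ^+ m = 1.
Proof.
rewrite -exprMn_comm ?mul_unip_inv ?expr1n //.
by rewrite /GRing.comm mul_inv_unip mul_unip_inv.
Qed.

Lemma unipX_exp2 k : u ^+ (2 ^ k) = 1 + z ^+ (2 ^ k).
Proof.
elim: k => [|k IH]; first by rewrite !expr1 -unipE.
rewrite expnS mul2n -addnn !exprD IH mulrDl mul1r mulrDr mulr1.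
by rewrite addrA -[1 + _ + _]addrA mxD_pchar2 // addr0.
Qed.

(** Since u has 2-power order, w^m is also a nonnegative power of u = 1 + z. This reduces traces
    with w to traces with powers of z. *)
Lemma invmxX_poly m : exists M (c : nat -> K), w ^+ m = \sum_(i < M) c i *: z ^+ i.
Proof.
pose k := (m + n)%N; have hk : (m + n <= 2 ^ k)%N by apply/ltnW/ltn_expl.
have u1 : u ^+ (2 ^ k) = 1.
  rewrite unipX_exp2 (_ : (2 ^ k = 2 ^ k - n + n)%N); last by lia.
  by rewrite exprD z_nilp mulr0 addr0.
have -> : w ^+ m = u ^+ (2 ^ k - m).
  rewrite -[LHS]mulr1 -u1 -{1}(subnKC (n := 2 ^ k) (m := m)); last by lia.
  by rewrite exprD mulrA mul_wX_uX mul1r.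
exists (2 ^ k - m).+1, (fun i => 'C(2 ^ k - m, i)%:R).
rewrite {1}unipE addrC exprD1n; apply: eq_bigr => i _.
by rewrite scaler_nat.
Qed.

Lemma mxtrace_unip_eq0 l A B :
  (forall i, \tr (z ^+ i * A * B) = 0) -> \tr (w ^+ l * A * B) = 0.
Proof.
move=> H; have [M [c ->]] := invmxX_poly l.
rewrite !mulr_suml raddf_sum big1 // => i _.
by rewrite /= -!mulmxE -!scalemxAl !mulmxE mxtraceZ H mulr0.
Qed.

(** Here w^q = 1 + z^q w^q, and the second summand contributes the trace of a nilpotent matrix. *)
Lemma mxtrace_wX_sqr k B : let q := (2 ^ k)%N in GRing.comm B (z ^+ q) ->
  \tr (w ^+ q * (B * B)) = \tr B ^+ 2.
Proof.
move=> q cB; have q0 : (0 < q)%N by rewrite expn_gt0.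
have cw : GRing.comm B (w ^+ q).
  apply: comm_inv (mul_wX_uX q) (mul_uX_wX q) _.
  by rewrite unipX_exp2; apply: commrD => //; exact: commr1.
have cz : GRing.comm (w ^+ q) (z ^+ q).
  exact/commrX/commr_sym/commrX/commr_sym/comm_wz.
have cE : w ^+ q = 1 + z ^+ q * w ^+ q.
  have c1 : w ^+ q + w ^+ q * z ^+ q = 1.
    by rewrite -(mul_wX_uX q) unipX_exp2 mulrDr mulr1.
  by rewrite -{1}c1 -cz -addrA mxD_pchar2 // addr0.
rewrite cE mulrDl mul1r raddfD /= mxtrace_sqr // -mulrA (mxtrace_mul_nilp q0).
  by rewrite addr0.
by apply/commr_sym; do 2 ?apply: commrM; apply/commr_sym.
Qed.

(** From w^(q-1) = w^q (1 + z) the trace becomes two sums of symmetric terms g i j, with i + j = q -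
    1 and i + j = q. Equal terms cancel in pairs: nothing is left of the first sum, and only g h h
    of the second. *)
Lemma mxtrace_pairing_exp2 b A : let h := (2 ^ b)%N in let q := (2 ^ b.+1)%N in
  adn z q A = 0 ->
  \tr (w ^+ q.-1 * adn z q.-1 A * A) = \tr (z ^+ h * A) ^+ 2.
Proof.
move=> h q hA; have qE : q = (h + h)%N by rewrite /q expnS mul2n addnn.
have h0 : (0 < h)%N by rewrite expn_gt0.
have q0 : (0 < q)%N by rewrite expn_gt0.
have cA : GRing.comm A (z ^+ q) by exact/(adn_exp2_eq0 _ hK).
pose c := w ^+ q.
have cwA : GRing.comm A c.
  apply: comm_inv (mul_wX_uX q) (mul_uX_wX q) _.
  by rewrite unipX_exp2; apply: commrD => //; exact: commr1.
have cz i : GRing.comm c (z ^+ i) by exact/commrX/commr_sym/commrX/commr_sym/comm_wz.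
have wE : w ^+ q.-1 = c * u.
  have -> : c = w ^+ q.-1 * w by rewrite -exprSr prednK // expn_gt0.
  by rewrite -mulrA mul_inv_unip mulr1.
pose g i j := \tr (c * z ^+ i * A * z ^+ j * A).
have gC i j : g i j = g j i.
  rewrite /g -[c * _ * _ * _ * _]mulrA mxtrace_mulrC !mulrA -[_ * A * c]mulrA.
  by rewrite cwA mulrA -cz.
(* This is the trace of z^q times a matrix commuting with z^q, which is nilpotent. *)
have g0 : g q 0%N = 0.
  rewrite /g expr0 mulr1 cz -!mulrA; apply: mxtrace_mul_nilp.
    by rewrite expn_gt0.
  by apply/commr_sym; do 2 ?apply: commrM; apply/commr_sym.
have gh : g h h = \tr (z ^+ h * A) ^+ 2.
  set B := z ^+ h * A; have cB : GRing.comm (z ^+ q) B.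
    by apply: commrM; [rewrite /GRing.comm -!exprD addnC | exact/commr_sym].
  have -> : g h h = \tr (c * (B * B)) by rewrite /g /B !mulrA.
  exact/mxtrace_wX_sqr/commr_sym.
rewrite wE adn_exp2_pred // -/q.
have -> : \tr (c * u * (\sum_(l < q) z ^+ l * A * z ^+ (q.-1 - l)) * A) =
   \sum_(l < q) g l (q.-1 - l)%N + \sum_(l < q) g l.+1 (q.-1 - l)%N.
  rewrite {1}unipE mulrDr mulr1 !mulrDl raddfD /=; congr (_ + _).
    rewrite mulr_sumr mulr_suml raddf_sum; apply: eq_bigr => l _.
    by rewrite /g !mulrA.
  rewrite mulr_sumr mulr_suml raddf_sum; apply: eq_bigr => l _.
  by rewrite /g exprS !mulrA.
have -> : \sum_(l < q) g l (q.-1 - l)%N = 0.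
  rewrite qE big_split_ord /= [X in _ + X](reindex_inj rev_ord_inj) -big_split big1 //=.
  move=> i _; have hi := ltn_ord i.
  rewrite [X in _ + X]gC (_ : (h + h).-1 - (h + (h - i.+1)) = i)%N; last by lia.
  by rewrite (_ : (h + (h - i.+1)) = (h + h).-1 - i)%N ?addrr_pchar2 //; lia.
(* The missing end term g 0 q is zero; adding it makes the range symmetric about h. *)
have -> : \sum_(l < q) g l.+1 (q.-1 - l)%N = \sum_(l < q.+1) g l (q - l)%N.
  rewrite [RHS]big_ord_recl subn0 [g _ q]gC g0 add0r; apply: eq_bigr => i _.
  by rewrite lift0; congr g; lia.
have -> : q.+1 = (h + (1 + h))%N by lia.
rewrite add0r !big_split_ord /= big_ord1 addn0 addrCA.
rewrite [X in _ + (_ + X)](reindex_inj rev_ord_inj) -big_split big1 ?addr0 /=.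
  by rewrite (_ : q - h = h)%N //; lia.
move=> i _; have hi := ltn_ord i.
rewrite [X in _ + X]gC (_ : q - (h + (1 + (h - i.+1))) = i)%N; last by lia.
by rewrite (_ : (h + (1 + (h - i.+1))) = q - i)%N ?addrr_pchar2 //; lia.
Qed.

End Unipotent.

(** * Conjugation and b_V in terms of the commutator *)

Section TensOp.
Variables (K : fieldType) (n : nat) (u : 'M[K]_n).
Hypotheses (hK : 2%N \in [pchar K]) (u_unit : u \in unitmx).
Local Notation z := (u - 1%:M).
Local Notation w := (invmx u).

(* b_V(X^(d-1) A, A) *)
Definition qform d A : K :=
  \tr (w ^+ d.-1 * adn z d.-1 A * A) + \tr (w ^+ d.-1 * adn z d.-1 A) * \tr A.

(** In characteristic 2, w A u - A = w (A u + u A), and the identity part of u cancels. *)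
Lemma mul_vec_tens_op (A : 'M[K]_n) : mxvec A *m tens_op u = mxvec (w * adn z 1 A).
Proof.
rewrite /tens_op mulmxBr mulmx1.
rewrite (_ : (fun A0 : 'M_n => _) = mulmxr u \o mulmx (invmx u)) // mul_vec_lin.
rewrite -linearB /= !mulmxE; congr (mxvec _).
rewrite adnS adn0 mulrBl mulrBr mul1r mulr1 addrACA !mulrDr mulrA.
by rewrite mxD_pchar2 // addr0 (mul_inv_unip u_unit) mul1r mxN_pchar2 // addrC mulrA.
Qed.

Lemma mul_vec_tens_opX m (A : 'M[K]_n) :
  mxvec A *m tens_op u ^+ m = mxvec (w ^+ m * adn z m A).
Proof.
elim: m => [|m IH]; first by rewrite !expr0 mulmx1 mul1r.
rewrite exprSr -mulmxE mulmxA IH mul_vec_tens_op.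
have cw : GRing.comm (w ^+ m) z by apply/commr_sym/commrX/commr_sym/comm_wz.
by rewrite adn_mull // exprS !mulrA adnS.
Qed.

Lemma bV_mxvec (A B : 'M[K]_n) : bV (mxvec A) (mxvec B) = \tr (A * B) + \tr A * \tr B.
Proof. by rewrite /bV !mxvecK. Qed.

Lemma eps_oneP d : eps_one (tens_op u) (@bV K n) (1%:M : 'M[K]_(n * n))
    (0 : 'M[K]_(1, n * n)) d <->
  exists A, adn z d A = 0 /\ qform d A != 0.
Proof.
have wX m : w ^+ m * u ^+ m = 1 by exact: mul_wX_uX.
split=> [[v [_ hv bv]]|[A [hA qA]]].
  exists (vec_mx v); rewrite -[v]vec_mxK mul_vec_tens_opX in hv.
  split.
    move: hv => /submx0null/eqP; rewrite mxvec_eq0 => /eqP hv.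
    by rewrite -[LHS]mul1r -(mul_uX_wX u_unit d) -mulrA hv mulr0.
  by rewrite /qform -bV_mxvec -mul_vec_tens_opX vec_mxK.
exists (mxvec A); split; first exact: submx1.
  by rewrite mul_vec_tens_opX hA mulr0 linear0 sub0mx.
by rewrite mul_vec_tens_opX bV_mxvec.
Qed.

(** The value of b_V at A and the identity is tr A + n tr A. So the perp is everything for odd n and
    the traceless matrices for even n. *)
Lemma sub_gamma_perp (A : 'M[K]_n) :
  (mxvec A <= gamma_perp K n)%MS = (\tr A * n.+1%:R == 0).
Proof.
rewrite /gamma_perp sub_kermx.
have -> : mxvec A *m (\col_i bV (delta_mx 0 i) (gamma K n)) =
          const_mx (\tr A * n.+1%:R).
  apply/matrixP=> i j; rewrite !mxE -[in RHS](mxvecK A).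
  rewrite {2}(row_sum_delta (mxvec A)) !linear_sum mulr_suml /=.
  apply: eq_bigr => k _; rewrite !linearZ /= mxE ord1 -mulrA; congr (_ * _).
  by rewrite /bV /gamma mxvecK mulmx1 mxtrace1 -natr1 mulrDr mulr1 addrC.
apply/eqP/eqP => [/matrixP/(_ 0 0)|->]; first by rewrite !mxE.
by apply/matrixP=> i j; rewrite !mxE.
Qed.

Lemma eps'_oneP d : eps_one (tens_op u) (@bV K n) (gamma_perp K n) (gamma K n) d <->
  exists A, [/\ \tr A * n.+1%:R = 0, exists c, adn z d A = c *: u ^+ d & qform d A != 0].
Proof.
split=> [[v [hU hv bv]]|[A [tA [c hA] qA]]].
  exists (vec_mx v); rewrite -[v]vec_mxK mul_vec_tens_opX in hv.
  rewrite -[v]vec_mxK sub_gamma_perp in hU; split; first exact/eqP.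
    move/sub_rVP: hv => [c]; rewrite /gamma -linearZ => /(can_inj mxvecK) hv.
    exists c; rewrite -[LHS]mul1r -(mul_uX_wX u_unit d) -mulrA hv.
    by rewrite -mulmxE -scalemxAr mulmx1.
  by rewrite /qform -bV_mxvec -mul_vec_tens_opX vec_mxK.
exists (mxvec A); split; first by rewrite sub_gamma_perp tA.
  rewrite mul_vec_tens_opX hA; apply/sub_rVP; exists c; rewrite /gamma -linearZ.
  by rewrite -mulmxE -scalemxAr mulmxE mul_wX_uX.
by rewrite mul_vec_tens_opX bV_mxvec.
Qed.
End TensOp.

(** * Where eps takes the value 1 *)

Section Epsilon.
Variables (K : fieldType) (n : nat) (u : 'M[K]_n) (s : seq nat).
Hypotheses (hK : 2%N \in [pchar K]) (u_unit : u \in unitmx).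
Local Notation z := (u - 1%:M).
Local Notation w := (invmx u).
Hypothesis z_nilp : z ^+ n = 0.
Hypothesis zJ : jordan_iso z (1%:M : 'M[K]_n) (0 : 'M[K]_(1, n)) s.

Lemma comm_wXz m : GRing.comm (w ^+ m) z.
Proof. by apply/commr_sym/commrX/commr_sym/comm_wz. Qed.

(** The commutator kills the identity, so its image is orthogonal to it; this removes the product of
    traces from [qform]. *)
Lemma mxtrace_wX_adn l m A : (0 < m)%N -> \tr (w ^+ l * adn z m A) = 0.
Proof.
case: m => // m _; rewrite -adn_mull; last exact: comm_wXz.
rewrite -[adn _ _ _]mulr1 mxtrace_adn (_ : adn z m.+1 1 = 0) ?mulr0 ?mxtrace0 //.
by rewrite adnSr mulr1 mul1r mxD_pchar2 // linear0.
Qed.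

Lemma mxtrace_adn0 m A : (0 < m)%N -> \tr (adn z m A) = 0.
Proof. by move=> m0; rewrite -[adn _ _ _]mul1r -(expr0 w) mxtrace_wX_adn. Qed.

Lemma qform1 A : qform u 1 A = 0.
Proof. by rewrite /qform expr0 mul1r adn0 mxtrace_sqr // addrr_pchar2. Qed.

Lemma qformE d A : (1 < d)%N -> qform u d A = \tr (w ^+ d.-1 * adn z d.-1 A * A).
Proof. by case: d => [|[|d]] // _; rewrite /qform mxtrace_wX_adn // mul0r addr0. Qed.

Lemma qform_exp2 b A : adn z (2 ^ b.+1) A = 0 ->
  qform u (2 ^ b.+1) A = \tr (z ^+ (2 ^ b) * A) ^+ 2.
Proof.
by move=> hA; rewrite qformE ?mxtrace_pairing_exp2 // -{1}(expn0 2) ltn_exp2l.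
Qed.

Lemma qform_between b d A : (2 ^ b < d < 2 ^ b.+1)%N -> adn z d A = 0 ->
  qform u d A = 0.
Proof.
move=> hd hA; rewrite qformE; last first.
  by case/andP: hd => + _; apply: leq_ltn_trans; rewrite expn_gt0.
apply: mxtrace_unip_eq0 => // i; exact: (jordan_form_pairing0 hK zJ i hd hA).
Qed.

Lemma exp2_bracket d : (1 < d)%N -> exists b, (2 ^ b < d <= 2 ^ b.+1)%N.
Proof.
move=> d1; exists (up_log 2 d).-1.
by rewrite prednK ?up_log_gt0 //; exact: up_log_bounds.
Qed.

Lemma qform_nonzero d A : (0 < d)%N -> adn z d A = 0 -> qform u d A != 0 ->
  exists b, d = (2 ^ b.+1)%N /\ \tr (z ^+ (2 ^ b) * A) != 0.
Proof.
move=> d0 hA qA; have d1 : (1 < d)%N.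
  by rewrite ltn_neqAle d0 andbT; apply: contra_neq qA => <-; rewrite qform1.
have [b /andP[bd]] := exp2_bracket d1; rewrite leq_eqVlt => /predU1P[dE|db].
  exists b; split=> //; apply: contra_neq qA => t0.
  by rewrite dE qform_exp2 ?t0 ?expr0n // -dE.
by case/eqP: qA; apply: (qform_between (b := b)) => //; rewrite bd.
Qed.

Lemma qform_nonzeroP d : (0 < d)%N ->
  (exists A, adn z d A = 0 /\ qform u d A != 0) <->
  exists beta, d = (2 ^ beta)%N /\ (1 < d)%N /\
    (exists r, r \in s /\ occurs_cob beta r).
Proof.
move=> d0; split=> [[A [hA qA]]|[[|b] [dE [d1 [r [rs occ]]]]]].
- have [b [dE tA]] := qform_nonzero d0 hA qA; exists b.+1; split=> //.
  split; first by rewrite dE -{1}(expn0 2) ltn_exp2l.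
  pose W r := (2 ^ b < r %% (4 * 2 ^ b) < 3 * 2 ^ b)%N.
  have [/hasP[r rs Wr]|/hasPn noW] := boolP (has W s).
    by exists r; split=> //; apply/occurs_cob_window.
  (* If no block size is in the window, z^h with h = 2^b is in the image of ad^(4h-1), hence
     orthogonal to A, which ad^(2h) kills. *)
  have [|B hB] := jordan_formX_adn hK zJ (k := b.+2) (e := 2 ^ b).
    apply/allP=> r /noW; rewrite /W !expnS mulnA negb_and -!leqNgt.
    by case/orP=> H; apply/orP; [left | right; lia].
  case/eqP: tA; rewrite -hB mxtrace_adn.
  rewrite (@adn_ker_le _ _ _ d) ?mulr0 ?mxtrace0 // dE [X in (_ <= X.-1)%N]expnS.
  by have : (0 < 2 ^ b.+1)%N by [rewrite expn_gt0]; lia.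
- by rewrite dE in d1.
- move/occurs_cob_window: occ => W; have h0 : (0 < 2 ^ b)%N by rewrite expn_gt0.
  have rm : (r %% 2 ^ b.+1 < 2 ^ b.+1)%N by rewrite ltn_mod expn_gt0.
  have := modn_double (2 ^ b.+1) r.
  have -> : (2 ^ b.+1 + 2 ^ b.+1 = 4 * 2 ^ b)%N by rewrite expnS; lia.
  have qE : (2 ^ b.+1 = 2 * 2 ^ b)%N by rewrite expnS.
  (* The window modulo 4h is exactly the condition for a dual matrix Y to z^h that commutes with
     z^(2h). *)
  move=> mE; have [| |Y [cY tY]] :=
    @comm_jordan_form_trace _ _ _ _ hK zJ r (2 ^ b.+1) (2 ^ b) rs.
  + lia.
  + by move: mE; case: (odd _); lia.
  exists Y; have hY : adn z d Y = 0 by rewrite dE; apply/adn_exp2_eq0.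
  by rewrite dE in hY *; rewrite qform_exp2 // tY eqxx expr1n oner_neq0.
Qed.

(** Adding a multiple of z^h A corrects the trace without changing tr(z^h A), because z^(2h) A has
    trace zero. *)
Lemma qform_nonzero_tr0 d : (0 < d)%N ->
  (exists A, adn z d A = 0 /\ qform u d A != 0) ->
  exists A, [/\ \tr A = 0, adn z d A = 0 & qform u d A != 0].
Proof.
move=> d0 [A [hA qA]]; have [b [dE tA]] := qform_nonzero d0 hA qA.
pose t := \tr A / \tr (z ^+ (2 ^ b) * A); pose A' := A + t *: (z ^+ (2 ^ b) * A).
have hA' : adn z d A' = 0.
  rewrite linearD linearZ /= hA add0r adn_mull ?hA ?mulr0 ?scaler0 //.
  exact/commr_sym/commrX.
exists A'; split=> //.
  by rewrite raddfD /= mxtraceZ /t divfK // addrr_pchar2.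
rewrite dE in hA' *; rewrite qform_exp2 // expf_neq0 // mulrDr raddfD /=.
rewrite -mulmxE -scalemxAr mxtraceZ mulmxE mulrA -exprD addnn -mul2n -expnS.
rewrite (mxtrace_mul_nilp hK z_nilp (m := 2 ^ b.+1)) ?mulr0 ?addr0 ?expn_gt0 //.
by apply/(adn_exp2_eq0 _ hK); rewrite -dE.
Qed.

End Epsilon.

(** * The induced form on the subquotient *)

Section Invariant.
Variables (K : fieldType) (n : nat) (u : 'M[K]_n) (s : seq nat) (alpha : nat).
Hypotheses (hK : 2%N \in [pchar K]) (u_unit : u \in unitmx).
Local Notation z := (u - 1%:M).
Local Notation w := (invmx u).
Local Notation q := (2 ^ alpha)%N.
Hypothesis z_nilp : z ^+ n = 0.
Hypothesis zJ : jordan_iso z (1%:M : 'M[K]_n) (0 : 'M[K]_(1, n)) s.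
Hypothesis q_dvd : all (dvdn q) s.

Let q_gt0 : (0 < q)%N. Proof. by rewrite expn_gt0. Qed.

Lemma exists_trace1 : has (fun d => odd (d %/ q)) s ->
  exists Y, adn z q Y = 0 /\ \tr Y = 1.
Proof.
move=> /hasP[d ds dodd]; have /eqP dq := allP q_dvd d ds.
have [//| |Y [cY tY]] := comm_jordan_form_trace (h := q) (k := 0) hK zJ ds.
  by rewrite dodd dq subn0.
exists Y; split; first exact/(adn_exp2_eq0 _ hK).
by have := tY 0%N; rewrite expr0 mul1r.
Qed.

(** Take T = u^(q-1) B with ad^(q-1) B = 1. In the binomial expansion of u only z^(q-1) has a
    nonzero trace against B, so tr T is the parity of n / q, and w T, where u occurs to the power q
    - 2, has trace zero. *)
Lemma exists_preim1 : exists T, [/\ adn z q.-1 T = u ^+ q.-1,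
  \tr T = (odd (n %/ q))%:R & ((0 < q.-1)%N -> \tr (w * T) = 0)].
Proof.
have [B [hB tB]] := jordan_form1_adn hK zJ q_dvd.
exists (u ^+ q.-1 * B).
have trU j : \tr (u ^+ j * B) = \sum_(i < j.+1) 'C(j, i)%:R * \tr (z ^+ i * B).
  rewrite {1}(unipE u) addrC exprD1n mulr_suml raddf_sum; apply: eq_bigr => i _.
  by rewrite /= -scaler_nat -mulmxE -scalemxAl mxtraceZ.
split.
- rewrite adn_mull ?hB ?mulr1 //; exact/commr_sym/commrX/commr_sym/comm_uz.
- rewrite trU big_ord_recr /= binn mul1r tB eqxx big1 ?add0r // => i _.
  by rewrite tB ltn_eqF ?mulr0 //; have := ltn_ord i.
- move=> q1; rewrite mulrA -{1}(prednK q1) exprS mulrA (mul_inv_unip u_unit) mul1r trU.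
  rewrite big1 // => i _; rewrite tB ltn_eqF ?mulr0 //.
  by have := ltn_ord i; lia.
Qed.

(** The identity is in the image of ad^(q-1), hence orthogonal to the kernel of ad^d. *)
Lemma adn_ker_tr0 d A : (d < q)%N -> adn z d A = 0 -> \tr A = 0.
Proof.
move=> dq hA; have [B [hB _]] := jordan_form1_adn hK zJ q_dvd.
rewrite -[A]mulr1 -hB -mxtrace_adn (@adn_ker_le _ _ _ d) ?mul0r ?mxtrace0 //.
by lia.
Qed.

(** For d >= q, pairing with the matrix Y of trace 1 killed by ad^q would give c = 0. *)
Lemma adn_scalar_lt d A c : has (fun d => odd (d %/ q)) s -> c != 0 ->
  adn z d A = c *: u ^+ d -> (d < q)%N.
Proof.
move=> q_odd c0 hA; rewrite ltnNge; apply/negP=> qd.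
have [Y [hY tY]] := exists_trace1 q_odd; case/eqP: c0.
have : \tr (w ^+ d * adn z d A * Y) = 0.
  rewrite -adn_mull; last exact: comm_wXz.
  by rewrite mxtrace_adn (adn_ker_le qd hY) mulr0 mxtrace0.
rewrite hA -mulmxE -scalemxAr -scalemxAl mxtraceZ mulmxE mul_wX_uX //.
by rewrite mul1r tY mulr1.
Qed.

(** The vector X^e T satisfies X^d (X^e T) = 1; adjointness moves all powers of ad onto one
    factor. *)
Lemma qform_lift d e T : (1 < d)%N -> adn z q.-1 T = u ^+ q.-1 ->
  (d + e = q.-1)%N ->
  qform u d (w ^+ e * adn z e T) = \tr (w ^+ q.-2 * adn z (q.-2 + e) T * (w ^+ e * T)).
Proof.
move=> d1 hT de; rewrite qformE // adn_mull; last exact: comm_wXz.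
rewrite [w ^+ d.-1 * (_ * _)]mulrA -exprD -adnD (_ : d.-1 + e = q.-2)%N; last by lia.
rewrite -[w ^+ e * adn z e T]adn_mull; last exact: comm_wXz.
rewrite -mxtrace_adn adn_mull; last exact: comm_wXz.
by rewrite -adnD addnC.
Qed.

Lemma qform_sub_ker d G B : (1 < d)%N -> adn z d B = 0 ->
  qform u d (G + B) = qform u d G + qform u d B.
Proof.
move=> d1 hB; rewrite !qformE //; case: d d1 hB => // d _ hB.
have cD := adn_last_comm hK hB.
rewrite linearD /= !mulrDr !mulrDl !raddfD /=.
have -> : \tr (w ^+ d * adn z d G * B) = \tr (w ^+ d * adn z d B * G).
  rewrite -adn_mull ?mxtrace_adn; last exact: comm_wXz.
  rewrite mxtrace_mulrC mulrA; congr (\tr (_ * _)).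
  apply/commrX/(comm_inv (mul_inv_unip u_unit) (mul_unip_inv u_unit)).
  by rewrite [X in GRing.comm _ X](unipE u); apply: commrD => //; exact: commr1.
by rewrite -!addrA; congr (_ + _); rewrite addrA addrr_pchar2 // add0r.
Qed.

(** With q - 2 = 2k and R = ad^k T, the trace is that of w^(q-2) R R, where w^(q-2) = w^q (1 + z^2).
    Commuting z past R leaves the squared traces of R and z R, both zero, and a term that ad^(q-1) T
    = u^(q-1) turns into tr T - tr(w T). *)
Lemma qform_top T : (2 < q.-1)%N -> adn z q.-1 T = u ^+ q.-1 -> \tr T = 0 ->
  \tr (w * T) = 0 -> \tr (w ^+ q.-2 * adn z q.-2 T * T) = 0.
Proof.
case: alpha => [|b] // q2 hT tT twT.
set Q := (2 ^ b.+1)%N in q2 hT *; pose k := (2 ^ b).-1.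
have b0 : (0 < 2 ^ b)%N by rewrite expn_gt0.
have QE : Q = (2 * (2 ^ b))%N by rewrite /Q expnS.
have Qk : Q.-2 = (k + k)%N by lia.
have k0 : (0 < k)%N by lia.
have hQ : adn z Q T = 0.
  rewrite -(prednK (n := Q)) ?expn_gt0 // adnS hT.
  rewrite (commrX _ (commr_sym (comm_uz u))) // mxD_pchar2 //.
have cz : GRing.comm (w ^+ Q) z by exact: comm_wXz.
pose R := adn z k T; pose R1 := adn z k.+1 T.
have R1E : z * R = R * z + R1 by rewrite /R1 adnS -/R addrCA mxD_pchar2 ?addr0.
have cR : GRing.comm R (z ^+ Q).
  by apply/(adn_exp2_eq0 _ hK); rewrite -/Q -adnD addnC adnD hQ linear0.
have czR : GRing.comm (z * R) (z ^+ Q).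
  apply/commr_sym/commrM; last exact/commr_sym.
  exact/commr_sym/commrX.
have tR : \tr R = 0 by exact: mxtrace_adn0.
have tzR : \tr (z * R) = 0 by rewrite -adn_mull // mxtrace_adn0.
have wE : w ^+ Q.-2 = w ^+ Q * (1 + z * z).
  rewrite -[1 + z * z](unipX_exp2 u hK 1) -[in RHS](subnK (n := Q) (m := 2)); last by lia.
  by rewrite exprD -mulrA mul_wX_uX // mulr1 subn2.
have -> : \tr (w ^+ Q.-2 * adn z Q.-2 T * T) = \tr (w ^+ Q.-2 * R * R).
  rewrite {2}Qk adnD -/R -adn_mull ?mxtrace_adn //; last exact: comm_wXz.
rewrite wE; set zz := z * z; rewrite mulrDr mulr1 !mulrDl raddfD /= -mulrA.
rewrite mxtrace_wX_sqr // tR expr0n add0r /= {}/zz.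
have -> : w ^+ Q * (z * z) * R * R =
   w ^+ Q * ((z * R) * (z * R)) + w ^+ Q * z * R1 * R.
  have gen (W Z S S1 : 'M[K]_n) : Z * S = S * Z + S1 ->
      W * (Z * Z) * S * S = W * ((Z * S) * (Z * S)) + W * Z * S1 * S.
    by move=> ZS; rewrite -!mulrA [Z * (S * S)]mulrA {1}ZS mulrDl !mulrDr !mulrA.
  exact: gen.
rewrite raddfD /= mxtrace_wX_sqr // tzR expr0n add0r /=.
rewrite -[w ^+ Q * z * R1]adn_mull; last first.
  by apply/commr_sym/commrM => //; exact/commr_sym.
rewrite mxtrace_adn /R -adnD.
have -> : (k.+1 + k = Q.-1)%N by lia.
rewrite hT mxtrace_mulrC !mulrA -(prednK (n := Q)) ?expn_gt0 // exprSr mulrA.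
rewrite mul_uX_wX // mul1r mulrBr mulr1 mul_inv_unip // mulrBl mul1r.
by rewrite raddfB /= tT twT subr0.
Qed.
Lemma qform_quotient d A c : has (fun d => odd (d %/ q)) s -> (0 < d)%N ->
  \tr A * n.+1%:R = 0 ->
  adn z d A = c *: u ^+ d -> qform u d A != 0 ->
  (exists B, adn z d B = 0 /\ qform u d B != 0) \/
  [&& ~~ odd n, (1 < alpha)%N & odd (n %/ q)] /\ d = (q - 2)%N.
Proof.
move=> q_odd d0 tA hA qA; have [c0|c_neq0] := eqVneq c 0.
  by left; exists A; rewrite hA c0 scale0r.
have cX : w ^+ d * adn z d A = c *: 1%:M.
  by rewrite hA -mulmxE -scalemxAr mulmxE mul_wX_uX.
have even_n : ~~ odd n.
  (* X^d A has trace zero, while c times the identity has trace c when n is odd. *)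
  apply: contra c_neq0 => odd_n; have := mxtrace_wX_adn hK u_unit d A d0.
  rewrite cX mxtraceZ mxtrace1 (natr_pchar2 hK) odd_n mulr1 => ->.
  exact: eqxx.
have {}tA : \tr A = 0.
  by move: tA; rewrite (natr_pchar2 hK) /= even_n mulr1.
have dq := adn_scalar_lt q_odd c_neq0 hA.
have [d1|d1] := leqP d 1.
  by move: qA; rewrite (_ : d = 1%N) ?qform1 ?eqxx //; lia.
have [T [hT tT twT]] := exists_preim1.
(* A is c times the standard solution G = X^e T plus an element of ker X^d, and the form is additive
   on this sum. The cases e = 0, e = 1 and e >= 2 then remain for G. *)
pose e := (q.-1 - d)%N; have de : (d + e = q.-1)%N by rewrite /e; lia.
pose G := w ^+ e * adn z e T; pose B := A - c *: G.
have hG : adn z d G = u ^+ d.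
  rewrite adn_mull; last exact: comm_wXz.
  by rewrite -adnD de hT -de addnC exprD mulrA mul_wX_uX // mul1r.
have hB : adn z d B = 0 by rewrite linearB linearZ /= hA hG subrr.
have tB : \tr B = 0 := adn_ker_tr0 dq hB.
have tG : \tr G = 0.
  move/eqP: tB; rewrite raddfB /= mxtraceZ tA sub0r oppr_eq0 mulf_eq0.
  by rewrite (negPf c_neq0) => /eqP.
have [qB|qB] := eqVneq (qform u d B) 0; last by left; exists B.
have {}qA : qform u d G != 0.
  apply: contraNneq qA => qG; have -> : A = c *: G + B by rewrite addrC subrK.
  rewrite qform_sub_ker // qB addr0 qformE // linearZ /= -mulmxE.
  by rewrite -!scalemxAr -scalemxAl !mxtraceZ mulmxE -qformE // qG !mulr0.
right; move: qA; rewrite /G (qform_lift d1 hT de).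
have [e0|e0] := posnP e.
  rewrite e0 addn0 expr0 mul1r => qA; case/eqP: qA.
  have dE : d = q.-1 by lia.
  have tT0 : \tr T = 0 by move: tG; rewrite /G e0 expr0 mul1r.
  have [q2|q2] := ltnP 2 q.-1; first by apply: qform_top => //; apply: twT; lia.
  have qE : q.-1 = 2%N by lia.
  by exfalso; case: alpha qE => [|b]; rewrite ?expn0 // expnS; lia.
have [e1|e1] := leqP e 1; last first.
  (* For e >= 2 the exponent reaches q, and ad^q T = 0. *)
  rewrite (_ : q.-2 + e = (e - 2) + q)%N; last by lia.
  rewrite adnD -(prednK q_gt0) adnS hT (commrX _ (commr_sym (comm_uz u))).
  by rewrite mxD_pchar2 // linear0 mulr0 mul0r mxtrace0 eqxx.
have {}e1 : e = 1%N by lia.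
(* For e = 1 the value is tr T, the parity of n / q. *)
rewrite e1 (_ : q.-2 + 1 = q.-1)%N; last by lia.
rewrite hT expr1 [u ^+ _](_ : _ = u ^+ q.-2 * u); last by rewrite -exprSr prednK //; lia.
rewrite [w ^+ _ * _]mulrA mul_wX_uX // mul1r mulrA mul_unip_inv // mul1r tT => oddq.
split; last by lia.
rewrite even_n; case: (odd _) oddq => [_|]; last by rewrite eqxx.
by rewrite andbT; case: alpha de e1 d1 => [|[|b]] //; rewrite ?expn0 ?expn1; lia.
Qed.

Lemma qform_exceptional : ~~ odd n -> (1 < alpha)%N -> odd (n %/ q) ->
  exists A c, [/\ \tr A * n.+1%:R = 0, adn z (q - 2) A = c *: u ^+ (q - 2)
    & qform u (q - 2) A != 0].
Proof.
move=> even_n alpha1 odd_q.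
have q4 : (4 <= q)%N by rewrite (@leq_pexp2l 2 2).
have [T [hT tT twT]] := exists_preim1.
have de : (q - 2 + 1 = q.-1)%N by lia.
exists (w ^+ 1 * adn z 1 T), 1; split.
- by rewrite mxtrace_wX_adn // mul0r.
- rewrite adn_mull; last exact: comm_wXz.
  by rewrite -adnD de hT -de addnC exprD mulrA mul_wX_uX // mul1r scale1r.
rewrite (qform_lift _ hT de); last by lia.
rewrite (_ : q.-2 + 1 = q.-1)%N; last by lia.
rewrite hT expr1 [u ^+ _](_ : _ = u ^+ q.-2 * u); last by rewrite -exprSr prednK //; lia.
by rewrite [w ^+ _ * _]mulrA mul_wX_uX // mul1r mulrA mul_unip_inv // mul1r tT odd_q oner_neq0.
Qed.

(** The number q - 2 is a power of 2 only for q = 4, and then the window asks for a block size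
    congruent to 2 modulo 4, whereas 4 divides them all. *)
Lemma not_qform_exceptional : (1 < alpha)%N ->
  ~ exists A, adn z (q - 2) A = 0 /\ qform u (q - 2) A != 0.
Proof.
move=> alpha1; have q4 : (4 <= q)%N by rewrite (@leq_pexp2l 2 2).
move/(qform_nonzeroP hK u_unit z_nilp zJ) => [|beta [qE [q1 [r [rs occ]]]]]; first by lia.
have := allP q_dvd r rs; case: alpha alpha1 qE => [|[|a]] // _.
case: beta occ => [|[|b]] occ; rewrite ?expn0 ?expn1 ?expnS; try lia.
move: occ => /occurs_cob_window; rewrite !expn0 muln1 => W aE.
have -> : (2 ^ a = 1)%N by lia.
by rewrite !muln1 /dvdn; lia.
Qed.

End Invariant.

(** * Ranks and multiplicities *)

Section Ranks.
Variable K : fieldType.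

Lemma mxrank_jblockX d k : \rank (jblock K d ^+ k) = (d - k)%N.
Proof.
have [kd|dk] := leqP k d; last first.
  rewrite (_ : jblock K d ^+ k = 0) ?mxrank0; first by apply/esym/eqP; rewrite subn_eq0 ltnW.
  by rewrite jblockXE; apply/matrixP=> i j; rewrite !mxE; case: eqP => // e;
    have := ltn_ord j; lia.
apply/eqP; rewrite eqn_leq; apply/andP; split.
  have -> : jblock K d ^+ k = pid_mx (d - k) *m jblock K d ^+ k.
    rewrite jblockXE; apply/matrixP=> i j; rewrite !mxE (bigD1 i) //= !mxE eqxx /=.
    rewrite big1 ?addr0 => [|l li]; last first.
      by rewrite !mxE eq_sym -val_eqE in li *; rewrite (negPf li) mul0r.
    by case: eqP => e; rewrite ?mulr0 // ltn_subRL addnC -e ltn_ord mul1r.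
  by apply: leq_trans (mxrankM_maxl _ _) _; rewrite rank_pid_mx // leq_subr.
(* The product with the transpose bounds the rank from below. *)
have e : jblock K d ^+ k *m (jblock K d ^+ k)^T = pid_mx (d - k).
  rewrite jblockXE; apply/matrixP=> i j; rewrite !mxE.
  have [hi|hi] := ltnP (i + k) d.
    rewrite (bigD1 (Ordinal hi)) //= !mxE eqxx mul1r big1 ?addr0 => [|l].
      by rewrite ltn_subRL (addnC k i) hi andbT eqn_add2r val_eqE.
    by rewrite -val_eqE !mxE /= => /negPf ->; rewrite mul0r.
  rewrite big1 => [|l _]; first by rewrite ltn_subRL addnC ltnNge hi andbF.
  by rewrite !mxE; case: eqP => e; rewrite ?mul0r //; have := ltn_ord l; lia.
have := mxrankM_maxl (jblock K d ^+ k) (jblock K d ^+ k)^T.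
by rewrite e rank_pid_mx // leq_subr.
Qed.

Lemma mxrank_jordan_nilX s k : \rank (jordan_nil K s ^+ k) = (\sum_(m <- s) (m - k))%N.
Proof.
elim: s => [|d s IH]; first by rewrite big_nil; apply/eqP; rewrite -leqn0 rank_leq_row.
by rewrite jordan_nil_cons expr_block_diag rank_diag_block_mx mxrank_jblockX IH big_cons.
Qed.

(** Modulo U', phi intertwines X^k with the k-th power of the Jordan matrix, so both have the same
    rank on the subquotient. *)
Lemma jordan_iso_rank m p q (X : 'M[K]_m) (U : 'M[K]_(p, m)) (U' : 'M[K]_(q, m)) s k :
  (U' *m X <= U')%MS -> jordan_iso X U U' s ->
  \rank (U *m X ^+ k + U')%MS = (\sum_(d <- s) (d - k) + \rank U')%N.
Proof.
move=> U'X [phi [phiU Uphi free comm]].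
have U'Xk : (U' *m X ^+ k <= U')%MS.
  elim: k => [|k IH]; first by rewrite expr0 mulmx1.
  rewrite exprS -mulmxE mulmxA; apply: submx_trans IH; exact: submxMr.
have commk : (jordan_nil K s ^+ k *m phi - phi *m X ^+ k <= U')%MS.
  elim: k {U'Xk} => [|k IH]; first by rewrite !expr0 mul1mx mulmx1 subrr sub0mx.
  have -> : jordan_nil K s ^+ k.+1 *m phi - phi *m X ^+ k.+1 =
     jordan_nil K s ^+ k *m (jordan_nil K s *m phi - phi *m X) +
     (jordan_nil K s ^+ k *m phi - phi *m X ^+ k) *m X.
    by rewrite !exprSr -!mulmxE mulmxBr mulmxBl !mulmxA addrA subrK.
  apply: addmx_sub; first exact: mulmx_sub.
  apply: submx_trans U'X; exact: submxMr.
have free_phi : row_free phi.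
  by apply/inj_row_free => v hv; apply: free; rewrite hv sub0mx.
rewrite -mxrank_jordan_nilX -(mxrankMfree _ free_phi) -mxrank_disjoint_sum; last first.
  apply/eqP; rewrite -submx0; apply/rV_subP => v; rewrite sub_capmx => /andP[/submxP[c ->]].
  by rewrite mulmxA => /free ->; rewrite mul0mx sub0mx.
apply/eqmx_rank/andP; rewrite !addsmx_sub !addsmxSr !andbT; split.
  apply: submx_trans (submxMr _ Uphi) _; rewrite addsmxMr addsmx_sub.
  rewrite (submx_trans U'Xk (addsmxSr _ _)) andbT.
  rewrite -[phi *m _](subKr (jordan_nil K s ^+ k *m phi)) addmx_sub ?addsmxSl //.
  by rewrite eqmx_opp (submx_trans commk) // addsmxSr.
rewrite -[_ *m phi](subrK (phi *m X ^+ k)) addmx_sub ?(submx_trans commk) ?addsmxSr //.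
by rewrite (submx_trans (submxMr _ phiU)) // addsmxSl.
Qed.

(** The multiplicity is the second difference of the ranks, written additively to avoid truncated
    subtraction. *)
Lemma count_mem_sum d s : (0 < d)%N ->
  (count_mem d s + 2 * \sum_(m <- s) (m - d) =
   \sum_(m <- s) (m - d.-1) + \sum_(m <- s) (m - d.+1))%N.
Proof.
move=> d0; elim: s => [|m s IH]; first by rewrite !big_nil.
rewrite !big_cons /=; move: IH; move: (count _ s) => c.
do 3 move: (bigop.body _ _ _) => ?; case: eqP => [->|ne]; rewrite ?mulnDr; lia.
Qed.

(** Restricting A to a hyperplane lowers the rank by one if the hyperplane contains the kernel, and
    otherwise not at all. *)
Lemma mxrank_hyperplane_mul_sub N p (H : 'M[K]_(p, N)) (A : 'M[K]_N) :
  (0 < N)%N -> \rank H = N.-1 -> (kermx A <= H)%MS ->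
  (\rank (H *m A)).+1 = \rank A.
Proof.
move=> N0 rH kH; have := mxrank_mul_ker H A; have := mxrank_ker A.
have -> : \rank (H :&: kermx A)%MS = \rank (kermx A) by rewrite (capmx_idPr kH).
by rewrite rH; have := rank_leq_row A; lia.
Qed.

Lemma mxrank_hyperplane_mul_nsub N p (H : 'M[K]_(p, N)) (A : 'M[K]_N) :
  \rank H = N.-1 -> ~~ (kermx A <= H)%MS -> (\rank (H *m A) = \rank A)%N.
Proof.
move=> rH kH; have := mxrank_mul_ker H A; have := mxrank_ker A.
have := mxrank_sum_cap H (kermx A).
have : (\rank H < \rank (H + kermx A)%MS)%N.
  rewrite ltn_neqAle mxrankS ?addsmxSl // andbT.
  apply: contra kH => /eqP e; have := addsmxSl H (kermx A).
  move=> h; have := (mxrank_leqif_sup h).2; rewrite e eqxx => /esym.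
  exact/submx_trans/addsmxSr.
rewrite rH; have := rank_leq_row A; have := rank_leq_col (H + kermx A)%MS; lia.
Qed.
End Ranks.

Lemma mxrank_adds_rV (K : fieldType) m N (A : 'M[K]_(m, N)) (v : 'rV[K]_N) :
  v != 0 -> (\rank (A + v)%MS + (v <= A)%MS = \rank A + 1)%N.
Proof.
move=> v0; have [vA|vA] := boolP (v <= A)%MS.
  by rewrite (addsmx_idPl vA).
rewrite addn0 mxrank_disjoint_sum ?rank_rV ?v0 //.
apply/eqP; rewrite -submx0; apply/rV_subP => x; rewrite sub_capmx.
case/andP=> xA /sub_rVP[c xE]; rewrite xE in xA *.
have [->|c0] := eqVneq c 0; first by rewrite scale0r sub0mx.
by case/negP: vA; rewrite -(eqmx_scale _ c0).
Qed.

(** * Ranks of X^k on all matrices and on the subquotient *)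

Section TensRanks.
Variables (K : fieldType) (n : nat) (u : 'M[K]_n).
Hypotheses (hK : 2%N \in [pchar K]) (u_unit : u \in unitmx) (n_gt0 : (0 < n)%N).
Local Notation z := (u - 1%:M).
Local Notation w := (invmx u).
Local Notation T := (tens_op u).
Local Notation H := (gamma_perp K n).
Local Notation g := (gamma K n).

Lemma gamma_neq0 : g != 0.
Proof.
rewrite /gamma mxvec_eq0; apply/eqP=> /matrixP/(_ (Ordinal n_gt0) (Ordinal n_gt0)).
by rewrite !mxE eqxx => /eqP; rewrite oner_eq0.
Qed.

Lemma gamma_tens_op : g *m T = 0.
Proof.
rewrite /gamma mul_vec_tens_op // adnS adn0 mulr1 mul1r mxD_pchar2 //.
by rewrite mulr0 linear0.
Qed.

Lemma tens_op_ker k (A : 'M[K]_n) : (mxvec A *m T ^+ k == 0) = (adn z k A == 0).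
Proof.
rewrite mul_vec_tens_opX // mxvec_eq0; apply/eqP/eqP => [e|->]; last by rewrite mulr0.
by rewrite -[LHS]mul1r -(mul_uX_wX u_unit k) -mulrA e mulr0.
Qed.

Lemma sub_ker_tens_op k (A : 'M[K]_n) : (mxvec A <= kermx (T ^+ k))%MS = (adn z k A == 0).
Proof. by rewrite sub_kermx tens_op_ker. Qed.

Lemma gamma_sub_mul p (U : 'M[K]_(p, n * n)) k : reflect
  (exists A, (mxvec A <= U)%MS /\ adn z k A = u ^+ k) (g <= U *m T ^+ k)%MS.
Proof.
apply: (iffP submxP) => [[D]|[A [/submxP[D AU] hA]]].
  rewrite mulmxA -[D *m U]vec_mxK mul_vec_tens_opX // => /(can_inj mxvecK) e.
  exists (vec_mx (D *m U)); rewrite vec_mxK submxMl; split=> //.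
  by rewrite -[LHS]mul1r -(mul_uX_wX u_unit k) -mulrA -e mulr1.
exists D; rewrite mulmxA -AU mul_vec_tens_opX // hA mul_wX_uX //.
Qed.

Lemma jordan_tens_rank t k : jordan_iso T (1%:M : 'M[K]_(n * n)) (0 : 'M[K]_(1, n * n)) t ->
  (\sum_(d <- t) (d - k))%N = \rank (T ^+ k).
Proof.
move=> ht; have := jordan_iso_rank k _ ht; rewrite mul0mx sub0mx => /(_ isT).
by rewrite mul1mx mxrank0 addn0 addsmx0 => <-.
Qed.

(** Dividing by gamma costs the image of X^k one dimension exactly when gamma lies in it. *)
Lemma jordan_quot_rank t k : jordan_iso T H g t ->
  (\sum_(d <- t) (d - k) + (g <= H *m T ^+ k)%MS)%N = \rank (H *m T ^+ k).
Proof.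
move=> ht; have := jordan_iso_rank k _ ht; rewrite gamma_tens_op sub0mx => /(_ isT).
have := mxrank_adds_rV (H *m T ^+ k) gamma_neq0.
by rewrite rank_rV gamma_neq0; lia.
Qed.

(** For odd n the perp is the whole space, and gamma, of nonzero trace, is in the image of X^k only
    for k = 0. *)
Lemma jordan_rank_odd t t' k : odd n ->
  jordan_iso T (1%:M : 'M[K]_(n * n)) (0 : 'M[K]_(1, n * n)) t ->
  jordan_iso T H g t' ->
  (\sum_(d <- t) (d - k) = \sum_(d <- t') (d - k) + (k == 0))%N.
Proof.
move=> odd_n ht ht'; rewrite (jordan_tens_rank k ht).
have n1 : n.+1%:R = 0 :> K by rewrite (natr_pchar2 hK) /= odd_n.
have HT : \rank (H *m T ^+ k) = \rank (T ^+ k).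
  rewrite eqmxMfull // -sub1mx; apply/rV_subP => v _.
  by rewrite -[v]vec_mxK sub_gamma_perp n1 mulr0.
rewrite -HT -(jordan_quot_rank k ht'); congr (_ + _)%N.
congr nat_of_bool; apply/gamma_sub_mul/eqP => [[A [_ hA]]|->].
  apply: contraPeq (mxtrace_wX_adn hK u_unit k A); rewrite -lt0n => k0 /(_ k0).
  by rewrite hA mul_wX_uX // mxtrace1 (natr_pchar2 hK) odd_n => /eqP; rewrite oner_eq0.
exists 1; rewrite adn0 expr0; split=> //.
by rewrite sub_gamma_perp n1 mulr0.
Qed.

Variables (s : seq nat) (alpha : nat).
Local Notation q := (2 ^ alpha)%N.
Hypothesis zJ : jordan_iso z (1%:M : 'M[K]_n) (0 : 'M[K]_(1, n)) s.
Hypothesis q_dvd : all (dvdn q) s.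

Let q_gt0 : (0 < q)%N. Proof. by rewrite expn_gt0. Qed.

(** The first correction is the dimension lost by restricting to traceless matrices, the second the
    one lost by dividing by gamma. *)
Lemma jordan_rank_even t t' k : has (fun d => odd (d %/ q)) s -> ~~ odd n ->
  jordan_iso T (1%:M : 'M[K]_(n * n)) (0 : 'M[K]_(1, n * n)) t ->
  jordan_iso T H g t' ->
  (\sum_(d <- t) (d - k) = \sum_(d <- t') (d - k) + (k < q) +
     ((k < q.-1) || (k == q.-1) && ~~ odd (n %/ q)))%N.
Proof.
move=> q_odd even_n ht ht'; rewrite (jordan_tens_rank k ht).
have n1 : n.+1%:R = 1 :> K by rewrite (natr_pchar2 hK) /= even_n.
have HE A : (mxvec A <= H)%MS = (\tr A == 0) by rewrite sub_gamma_perp n1 mulr1.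
have [Y [hY tY]] := exists_trace1 hK zJ q_dvd q_odd.
have [S [hS tS twS]] := exists_preim1 hK u_unit zJ q_dvd.
have nn_gt0 : (0 < n * n)%N by rewrite muln_gt0 n_gt0.
have rH : \rank H = (n * n).-1.
  rewrite /gamma_perp mxrank_ker -subn1; congr (_ - _)%N; apply/eqP.
  rewrite eqn_leq rank_leq_col lt0n mxrank_eq0; apply/eqP=> C0.
  have : (mxvec Y <= H)%MS by rewrite /gamma_perp C0 sub_kermx mulmx0.
  by rewrite HE tY oner_eq0.
have gH : (g <= H *m T ^+ k)%MS = ((k < q.-1) || (k == q.-1) && ~~ odd (n %/ q))%N.
  apply/gamma_sub_mul/idP => [[A [+ hA]]|].
    rewrite HE => tA.
    have kq : (k < q)%N.
      by apply: (adn_scalar_lt hK u_unit zJ q_dvd q_odd (oner_neq0 K) (A := A));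
        rewrite hA scale1r.
    have [kq1|kq1] := ltnP k q.-1; first by [].
    have kE : k = q.-1 by lia.
    (* Two preimages of gamma under X^(q-1) differ by an element of the kernel, so they have the
       same trace. *)
    have : \tr (A - S) = 0.
      by apply: (adn_ker_tr0 hK u_unit zJ q_dvd kq); rewrite linearB /= hA kE hS subrr.
    rewrite raddfB /= (eqP tA) tS sub0r => /eqP; rewrite oppr_eq0 kE eqxx /=.
    by case: odd => //; rewrite oner_eq0.
  have hG e : (k + e = q.-1)%N -> adn z k (w ^+ e * adn z e S) = u ^+ k.
    move=> ke; rewrite adn_mull; last exact: comm_wXz.
    by rewrite -adnD ke hS -ke addnC exprD mulrA mul_wX_uX // mul1r.
  case/orP=> [kq|/andP[/eqP kq even_q]].
    exists (w ^+ (q.-1 - k) * adn z (q.-1 - k) S); rewrite hG; last by lia.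
    by rewrite HE mxtrace_wX_adn // subn_gt0.
  exists S; rewrite HE tS (negPf even_q) eqxx; split=> //.
  by have := hG 0%N; rewrite addn0 expr0 mul1r; apply.
have := jordan_quot_rank k ht'; rewrite gH.
have [kq|kq] := ltnP k q.
  have kH : (kermx (T ^+ k) <= H)%MS.
    apply/rV_subP => v; rewrite -[v]vec_mxK sub_ker_tens_op HE => /eqP hv.
    by rewrite (adn_ker_tr0 hK u_unit zJ q_dvd kq hv).
  by have := mxrank_hyperplane_mul_sub nn_gt0 rH kH; lia.
have kH : ~~ (kermx (T ^+ k) <= H)%MS.
  apply/negP=> kH; have : (mxvec Y <= H)%MS.
    by apply: submx_trans kH; rewrite sub_ker_tens_op (adn_ker_le kq hY).
  by rewrite HE tY oner_eq0.
by have := mxrank_hyperplane_mul_nsub rH kH; lia.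
Qed.

(** If A commutes with z, then A = X^(q-1) (S A). So ker X lies in the image of X^(q-1), and the
    ranks fall by a constant up to X^q. *)
Lemma jordan_no_small t d : (0 < d < q)%N ->
  jordan_iso T (1%:M : 'M[K]_(n * n)) (0 : 'M[K]_(1, n * n)) t ->
  count_mem d t = 0%N.
Proof.
move=> /andP[d0 dq] ht; have := count_mem_sum t d0; rewrite !(jordan_tens_rank _ ht).
have [S [hS _ _]] := exists_preim1 hK u_unit zJ q_dvd.
have ker_im : (kermx T <= T ^+ q.-1)%MS.
  apply/rV_subP => v; rewrite -[v]vec_mxK -[T in kermx T]expr1 sub_ker_tens_op => /eqP hv.
  have cv := adn1_eq0 hK hv.
  apply/submxP; exists (mxvec (S * vec_mx v)).
  by rewrite mul_vec_tens_opX // adn_mulr // hS mulrA mul_wX_uX // mul1r.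
have step k : (k < q)%N -> \rank (T ^+ k) = (\rank (T ^+ k.+1) + \rank (kermx T))%N.
  move=> kq; have := mxrank_mul_ker (T ^+ k) T.
  have kT : (kermx T <= T ^+ k)%MS.
    apply: submx_trans ker_im _.
    by rewrite -(subnK (n := q.-1) (m := k)) ?exprD; [exact: submxMl | lia].
  by rewrite (capmx_idPr kT) exprSr.
have := step d.-1; have := step d dq; rewrite prednK //; lia.
Qed.

End TensRanks.

(** * The power of 2 dividing all block sizes, and the multiplicities *)

Lemma dvdn_biggcd m s : (m %| \big[gcdn/0]_(d <- s) d)%N = all (dvdn m) s.
Proof.
elim: s => [|d s IH]; first by rewrite big_nil dvdn0.
by rewrite big_cons dvdn_gcd IH.
Qed.

Lemma all_dvdn_logn_gcd p s : all (dvdn (p ^ logn p (\big[gcdn/0]_(d <- s) d))) s.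
Proof. by rewrite -dvdn_biggcd pfactor_dvdnn. Qed.

Lemma has_odd_logn_gcd s : (0 < size s)%N -> all (fun d => 0 < d)%N s ->
  has (fun d => odd (d %/ 2 ^ logn 2 (\big[gcdn/0]_(d <- s) d))) s.
Proof.
move=> s0 spos; set G := \big[gcdn/0%N]_(d <- s) d.
have Gs : all (dvdn G) s by rewrite -dvdn_biggcd.
have G0 : (0 < G)%N.
  case: s s0 spos @G Gs => // d s _ /= /andP[d0 _] /andP[+ _].
  by apply: contraTltn; rewrite leqn0 => /eqP ->; rewrite dvd0n -lt0n.
apply/negPn/negP=> /hasPn even_s.
have : (2 ^ (logn 2 G).+1 %| G)%N.
  rewrite {2}/G dvdn_biggcd; apply/allP=> d ds.
  have qd := allP (all_dvdn_logn_gcd 2 s) d ds.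
  by rewrite expnS -dvdn_divRL // dvdn2; apply: even_s.
by rewrite pfactor_dvdn // ltnn.
Qed.

(** The rank correction f is 2 below q - 1, 1 + c at q - 1 and 0 from q on, so its second difference
    is supported at q - 2, q - 1 and q. *)
Lemma second_difference_step q (c : bool) d l l' :
  let f k := ((k < q) + ((k < q.-1) || (k == q.-1) && c))%N in
  (0 < q)%N -> (0 < d)%N -> (l' + f d.-1 + f d.+1 = l + 2 * f d)%N ->
  [/\ (d.+2 < q)%N -> l' = l, d.+2 = q -> (l' + c = l + 1)%N,
      d.+1 = q -> l' = (l + 2 * c)%N, d = q -> (l' + 1 + c = l)%N
    & (q < d)%N -> l' = l].
Proof.
move=> f q0 d0; have f2 k : (k.+1 < q)%N -> f k = 2%N.
  by move=> h; rewrite /f ltn_predRL h ltnW.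
have f1 k : k.+1 = q -> f k = (1 + c)%N by move=> h; rewrite /f -h /= ltnSn ltnn eqxx.
have f0 k : (q <= k)%N -> f k = 0%N.
  move=> h; rewrite /f ltn_predRL ltnNge h ltnNge (leqW h) gtn_eqF //.
  by rewrite prednK.
move: f f2 f1 f0 => f f2 f1 f0 E.
split=> h; move: E.
- by rewrite !f2; lia.
- by rewrite (f2 d.-1) ?(f2 d) ?(f1 d.+1); lia.
- by rewrite (f2 d.-1) ?(f1 d) ?(f0 d.+1); lia.
- by rewrite (f1 d.-1) ?(f0 d) ?(f0 d.+1); lia.
- by rewrite !f0; lia.
Qed.

Theorem theoremA (K : closedFieldType) (hK : 2%N \in [pchar K])
  (n : nat) (hn : (1 < n)%N) (u : 'M[K]_n) (ds : seq nat)
  (lam lam' : nat -> nat) :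
  \det u = 1 ->
  (u - 1%:M) ^+ n = 0 ->
  (0 < size ds)%N ->
  all (fun d => 0 < d)%N ds ->
  jordan_iso (u - 1%:M) (1%:M : 'M[K]_n) (0 : 'M[K]_(1, n)) ds ->
  mult_decomp (tens_op u) (1%:M : 'M[K]_(n * n)) (0 : 'M[K]_(1, n * n)) lam ->
  mult_decomp (tens_op u) (gamma_perp K n) (gamma K n) lam' ->
  let alpha := logn 2 (\big[gcdn/0%N]_(d <- ds) d) in
  let eps := eps_one (tens_op u) (@bV K n) (1%:M : 'M[K]_(n * n))
                     (0 : 'M[K]_(1, n * n)) in
  let eps' := eps_one (tens_op u) (@bV K n) (gamma_perp K n) (gamma K n) in
  let caseb := [&& ~~ odd n, (1 < alpha)%N & odd (n %/ 2 ^ alpha)] in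
  (* (i) *)
  (odd n -> (lam' 1 + 1 = lam 1)%N /\ (forall d, 1 < d -> lam' d = lam d)%N) /\
  (* (ii) *)
  (~~ odd n -> alpha = 0%N ->
     (lam' 1 + 2 = lam 1)%N /\ (forall d, 1 < d -> lam' d = lam d)%N) /\
  (* (iii)(a) *)
  (~~ odd n -> (0 < alpha)%N -> ~~ odd (n %/ 2 ^ alpha) ->
     (lam' (2 ^ alpha) + 2 = lam (2 ^ alpha))%N /\
     lam' (2 ^ alpha - 1)%N = 2%N /\
     (forall d, 0 < d -> d != 2 ^ alpha -> d != 2 ^ alpha - 1 ->
        lam' d = lam d)%N) /\
  (* (iii)(b) *)
  (~~ odd n -> (1 < alpha)%N -> odd (n %/ 2 ^ alpha) ->
     (lam' (2 ^ alpha) + 1 = lam (2 ^ alpha))%N /\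
     lam' (2 ^ alpha - 2)%N = 1%N /\
     (forall d, 0 < d -> d != 2 ^ alpha -> d != 2 ^ alpha - 2 ->
        lam' d = lam d)%N) /\
  (* (iii)(c) *)
  (~~ odd n -> alpha = 1%N -> odd (n %/ 2) ->
     (lam' 2 + 1 = lam 2)%N /\
     (forall d, 0 < d -> d != 2 -> lam' d = lam d)%N) /\
  (* (iv) *)
  (forall d, (0 < d)%N ->
     (eps d <-> exists beta, d = (2 ^ beta)%N /\ (1 < d)%N /\
                   (exists r, r \in ds /\ occurs_cob beta r))) /\
  (* (v) *)
  (caseb ->
     ~ eps (2 ^ alpha - 2)%N /\ eps' (2 ^ alpha - 2)%N /\
     (forall d, (0 < d)%N -> d != (2 ^ alpha - 2)%N -> (eps' d <-> eps d))) /\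
  (* (vi) *)
  (~~ caseb -> forall d, (0 < d)%N -> (eps' d <-> eps d)).
Proof.
move=> det_u z_nilp ds0 ds_pos zJ [t [_ lamE ht]] [t' [_ lamE' ht']].
move=> alpha eps eps' caseb; set q := (2 ^ alpha)%N.
have u_unit : u \in unitmx by rewrite unitmxE det_u unitr1.
have n_gt0 : (0 < n)%N by exact: ltnW.
have q_dvd : all (dvdn q) ds by exact: all_dvdn_logn_gcd.
have q_odd : has (fun d => odd (d %/ q)) ds by exact: has_odd_logn_gcd.
have q_gt0 : (0 < q)%N by rewrite expn_gt0.
have epsP d : eps d <-> exists A, adn (u - 1%:M) d A = 0 /\ qform u d A != 0.
  exact: eps_oneP.
have eps'P d : eps' d <-> exists A, [/\ \tr A * n.+1%:R = 0,
    exists c, adn (u - 1%:M) d A = c *: u ^+ d & qform u d A != 0].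
  exact: eps'_oneP.
(* A traceless witness lies in the perp for either parity of n. *)
have eps_eps' d : (0 < d)%N -> eps d -> eps' d.
  move=> d0 /epsP /(qform_nonzero_tr0 hK u_unit z_nilp zJ d0) [A [tA hA qA]].
  by apply/eps'P; exists A; split; rewrite ?tA ?mul0r //; exists 0; rewrite scale0r.
have eps'_eps d : (0 < d)%N -> eps' d -> eps d \/ caseb /\ d = (q - 2)%N.
  move=> d0 /eps'P [A [tA [c hA] qA]].
  have [H|] := qform_quotient hK u_unit z_nilp zJ q_dvd q_odd d0 tA hA qA; last by right.
  by left; apply/epsP.
pose F k := (\sum_(d <- t) (d - k))%N; pose F' k := (\sum_(d <- t') (d - k))%N.
have lamF d : (0 < d)%N -> (lam d + 2 * F d = F d.-1 + F d.+1)%N.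
  by move=> d0; rewrite -lamE // count_mem_sum.
have lamF' d : (0 < d)%N -> (lam' d + 2 * F' d = F' d.-1 + F' d.+1)%N.
  by move=> d0; rewrite -lamE' // count_mem_sum.
have F_odd k : odd n -> F k = (F' k + (k == 0))%N.
  by move=> on; exact: (jordan_rank_odd hK u_unit n_gt0 k on ht ht').
pose c := ~~ odd (n %/ q).
pose f k := ((k < q) + ((k < q.-1) || (k == q.-1) && c))%N.
have F_even k : ~~ odd n -> F k = (F' k + f k)%N.
  move=> en; rewrite /f addnA.
  exact: (jordan_rank_even hK u_unit n_gt0 zJ q_dvd k q_odd en ht ht').
have lam_small d : (0 < d)%N -> (d < q)%N -> lam d = 0%N.
  move=> d0 dq; rewrite -lamE //.
  by apply: (jordan_no_small hK u_unit n_gt0 zJ q_dvd _ ht); rewrite d0.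
clearbody F F'.
have lam_odd d : odd n -> (0 < d)%N -> (lam' d + (d == 1) = lam d)%N.
  move=> on d0; move: (lamF d d0) (lamF' d d0); rewrite !F_odd //.
  by case: d d0 => // -[|d] _ /=; clear; lia.
have lam_even d : ~~ odd n -> (0 < d)%N -> [/\ (d.+2 < q)%N -> lam' d = lam d,
    d.+2 = q -> (lam' d + c = lam d + 1)%N, d.+1 = q -> lam' d = (lam d + 2 * c)%N,
    d = q -> (lam' d + 1 + c = lam d)%N & (q < d)%N -> lam' d = lam d].
  move=> en d0; apply: second_difference_step => //; rewrite -!/(f _).
  move: (lamF d d0) (lamF' d d0); rewrite !F_even //.
  by move: (f _) (f _) (f _) => *; lia.
split; [|split; [|split; [|split; [|split; [|split]]]]].
- move=> on; split=> [|d d1]; first by rewrite -(lam_odd 1%N).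
  by rewrite -(lam_odd d) // ?(gtn_eqF d1) ?addn0 // ltnW.
(* With q = 1 the quotient n / q is n itself, which is even, so both unit corrections fall on d =
   1. *)
- move=> en a0; have cE : c by rewrite /c /q a0 divn1.
  have qE : q = 1%N by rewrite /q a0.
  split=> [|d d1]; first by have [_ _ _ + _] := lam_even 1%N en isT; rewrite cE -addnA; apply.
  by have [_ _ _ _] := lam_even d en (ltnW d1); apply; rewrite qE.
- move=> en a0 cE; have q2 : (2 <= q)%N by rewrite (@leq_pexp2l 2 1).
  split; first by have [_ _ _ + _] := lam_even q en q_gt0; rewrite /c cE -addnA; apply.
  rewrite subn1; split.
    have q1 : (0 < q.-1)%N by rewrite -subn1 subn_gt0.
    have [_ _ + _ _] := lam_even q.-1 en q1; rewrite /c cE lam_small ?prednK //.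
    exact.
  move=> d d0 dq dq1; have [h1 h2 _ _ h5] := lam_even d en d0.
  have [/h5 //|dq'|e] := ltngtP q d; last by rewrite e eqxx in dq.
  have d1q : (d.+1 < q)%N by rewrite ltn_neqAle dq' andbT; apply: contraNneq dq1 => <-.
  move: d1q; rewrite leq_eqVlt => /predU1P[/h2|/h1 //].
  by rewrite /c cE => /addIn.
- move=> en a1 cE; have q4 : (4 <= q)%N by rewrite (@leq_pexp2l 2 2).
  split; first by have [_ _ _ + _] := lam_even q en q_gt0; rewrite /c cE addn0; apply.
  have q2 : (q - 2).+2 = q by rewrite -addn2 subnK // ltnW // ltnW.
  have q20 : (0 < q - 2)%N by rewrite subn_gt0 ltnW.
  split.
    (* Blocks smaller than q are absent upstairs, so the new block of size q - 2 has multiplicity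
       exactly one. *)
    have [_ + _ _ _] := lam_even (q - 2)%N en q20; rewrite /c cE lam_small ?addn0 //.
      exact.
    by rewrite -{2}q2 ltnS leqnSn.
  move=> d d0 dq dq2; have [h1 _ h3 _ h5] := lam_even d en d0.
  have [/h5 //|dq'|e] := ltngtP q d; last by rewrite e eqxx in dq.
  move: dq'; rewrite leq_eqVlt => /predU1P[/h3|]; first by rewrite /c cE addn0.
  rewrite leq_eqVlt => /predU1P[e|/h1 //].
  by rewrite -e -addn2 addnK eqxx in dq2.
- move=> en a1 cE; have qE : q = 2%N by rewrite /q a1.
  split; first by have [_ _ _ + _] := lam_even 2%N en isT; rewrite /c qE cE addn0; apply.
  case=> [//|[|[//|d]]] _ _.
    by have [_ _ + _ _] := lam_even 1%N en isT; rewrite /c qE cE addn0; apply.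
  by have [_ _ _ _] := lam_even d.+3 en isT; apply; rewrite qE.
- move=> d d0; apply: iff_trans (epsP d) _.
  exact: (qform_nonzeroP hK u_unit z_nilp zJ).
- split=> [cb|ncb d d0]; last first.
  split=> [/(eps'_eps d d0)[//|[cb _]]|/eps_eps' //]; last exact.
  by rewrite cb in ncb.
have /and3P[en a1 cE] := cb.
split; first by move/epsP; apply: (not_qform_exceptional hK u_unit z_nilp zJ q_dvd a1).
split.
  have [A [b [tA hA qA]]] := qform_exceptional hK u_unit zJ q_dvd en a1 cE.
  by apply/eps'P; exists A; split=> //; exists b.
move=> d d0 dne; split=> [/(eps'_eps d d0)[//|[_ de]]|/eps_eps']; last exact.
by rewrite de eqxx in dne.
Qed.
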